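(* Let $M$ be a $C^\infty$-manifold diffeomorphic to $\mathbb{R}^n$, equipped with a complete Riemannian metric of bounded nonpositive sectional curvature, i.e. there is a constant $k$ such that $-k^2\le K\le 0$. Then every nonempty weakly convex closed subset $G$ of $M$ is a deformation retract of $M$.
   Context: Let $d$ be the Riemannian distance on $M$. For a closed subset $G\subset M$ with complement $G^C=M\setminus G$, the projection onto $G$ is said to be unique if for every $x\in G^C$ there is exactly one point $y\in G$ with $d(x,y)=d(x,G)$; this point (which lies in $\partial G$) is denoted $\pi(x)$, giving a map $\pi:G^C\to\partial G$. For $x\in G^C$, let $\gamma:[0,\infty)\to M$ be the unit-speed geodesic ray with $\gamma(0)=\pi(x)$ passing through $x$; this ray is denoted $[\pi(x),x)$. The open horobowl (open horoball) associated with this ray is $\bigcup_{t>0}B(\gamma(t),t)$, where $B(p,r)$ is the open ball of center $p$ and radius $r$. A closed subset $G$ of $M$ is weakly convex if the projection onto $G$ is unique and, for every $x\in G^C$, the open horobowl associated with the ray $[\pi(x),x)$ does not intersect $G$ (i.e. every point of the ray other than its origin lies in $G^C$ and projects to $\pi(x)$). *)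

(* Defs.v *)
From HB Require Import structures.
From mathcomp Require Import all_boot all_order all_algebra.
From mathcomp Require Import all_classical all_reals all_analysis.

Set Implicit Arguments.
Unset Strict Implicit.
Unset Printing Implicit Defensive.

Import Order.TTheory GRing.Theory Num.Theory.
Import numFieldNormedType.Exports.

Local Open Scope classical_set_scope.
Local Open Scope ring_scope.

(* A manifold M diffeomorphic to R^n is given by a global chart
   phi : M -> R^n, namely the diffeomorphism: the topology of M is the one that
   makes phi a homeomorphism and its smooth structure is the one generated by
   phi.  A Riemannian metric on M is then its smooth matrix g : R^n -> 'M_n of
   coefficients g_ij in this chart. *)

Definition homeomorphism (S T : topologicalType) (f : S -> T) : Prop :=
  continuous f /\
  exists f' : T -> S, [/\ continuous f', cancel f f' & cancel f' f].

Definition partial (R : realType) (n : nat) (i : 'I_n) (f : 'rV[R]_n -> R) :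
    'rV[R]_n -> R :=
  fun x => 'D_(delta_mx 0 i) f x.

(* C^infty: every iterated partial derivative exists and is continuous. *)
Definition smooth (R : realType) (n : nat) (f : 'rV[R]_n -> R) : Prop :=
  forall s : seq 'I_n,
    let h := foldr (@partial R n) f s in
    continuous h /\ forall i x, derivable h x (delta_mx 0 i).

Definition inner (R : realType) (n : nat) (g : 'rV[R]_n -> 'M[R]_n)
    (x u v : 'rV[R]_n) : R :=
  (u *m g x *m v^T) 0 0.

Definition riemannian_metric (R : realType) (n : nat)
    (g : 'rV[R]_n -> 'M[R]_n) : Prop :=
  [/\ forall i j, smooth (fun x => g x i j),
      forall x, (g x)^T = g x
    & forall x v, v != 0 -> 0 < inner g x v v].

(* Gamma^k_ij =
     1/2 g^kl (partial_i g_jl + partial_j g_il - partial_l g_ij) *)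
Definition christoffel (R : realType) (n : nat) (g : 'rV[R]_n -> 'M[R]_n)
    (k i j : 'I_n) (x : 'rV[R]_n) : R :=
  2^-1 * \sum_(l < n) invmx (g x) k l *
    (partial i (fun y => g y j l) x + partial j (fun y => g y i l) x
     - partial l (fun y => g y i j) x).

(* R^l_ijk, where R(e_i, e_j) e_k = \sum_l R^l_ijk e_l and
   R(X, Y) Z = nabla_X nabla_Y Z - nabla_Y nabla_X Z - nabla_[X, Y] Z *)
Definition riemann (R : realType) (n : nat) (g : 'rV[R]_n -> 'M[R]_n)
    (l i j k : 'I_n) (x : 'rV[R]_n) : R :=
  partial i (christoffel g l j k) x - partial j (christoffel g l i k) x
  + \sum_(m < n) (christoffel g m j k x * christoffel g l i m x
                  - christoffel g m i k x * christoffel g l j m x).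

Definition curvature (R : realType) (n : nat) (g : 'rV[R]_n -> 'M[R]_n)
    (x u v w : 'rV[R]_n) : 'rV[R]_n :=
  \row_l \sum_(i < n) \sum_(j < n) \sum_(k < n)
    riemann g l i j k x * u 0 i * v 0 j * w 0 k.

(* Sectional curvature of the tangent plane spanned by u and v; meaningful only
   for linearly independent u, v. *)
Definition sectional_curvature (R : realType) (n : nat)
    (g : 'rV[R]_n -> 'M[R]_n) (x u v : 'rV[R]_n) : R :=
  inner g x (curvature g x u v v) u /
  (inner g x u u * inner g x v v - inner g x u v ^+ 2).

Definition C1_curve (R : realType) (n : nat) (c : R -> 'rV[R]_n) : Prop :=
  (forall t, derivable c t 1) /\ continuous (derive1 c).

Definition curve_length (R : realType) (n : nat) (g : 'rV[R]_n -> 'M[R]_n)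
    (c : R -> 'rV[R]_n) : R :=
  \int[lebesgue_measure]_(t in `[0, 1])
    Num.sqrt (inner g (c t) (derive1 c t) (derive1 c t)).

(* joined_by g p q L: some piecewise C^1 curve from p to q, presented as a
   finite concatenation of C^1 arcs parametrized by [0, 1], has length L.
   (Every C^1 arc on [0, 1] is the restriction of a C^1 curve on the line.) *)
Inductive joined_by (R : realType) (n : nat) (g : 'rV[R]_n -> 'M[R]_n) :
    'rV[R]_n -> 'rV[R]_n -> R -> Prop :=
| joined_nil p : joined_by g p p 0
| joined_cons (c : R -> 'rV[R]_n) q L :
    C1_curve c -> joined_by g (c 1) q L ->
    joined_by g (c 0) q (curve_length g c + L).

Definition riemannian_dist (R : realType) (n : nat) (M : Type)
    (phi : M -> 'rV[R]_n) (g : 'rV[R]_n -> 'M[R]_n) (x y : M) : R :=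
  inf [set L | joined_by g (phi x) (phi y) L].

Definition complete_dist (R : realType) (M : Type) (d : M -> M -> R) : Prop :=
  forall u : nat -> M,
    (forall e : R, 0 < e ->
       exists N, forall i j, (N <= i)%N -> (N <= j)%N -> d (u i) (u j) < e) ->
    exists l, forall e : R, 0 < e ->
       exists N, forall i, (N <= i)%N -> d (u i) l < e.

(* gamma is only relevant on [0, +oo[.  In the chart, its velocity v is
   continuous up to t = 0, has g-norm 1, and satisfies the geodesic equation
   v'^k = - \sum_(i, j) Gamma^k_ij v^i v^j. *)
Definition unit_speed_geodesic_ray (R : realType) (n : nat) (M : Type)
    (phi : M -> 'rV[R]_n) (g : 'rV[R]_n -> 'M[R]_n) (gamma : R -> M) : Prop :=
  let c : R -> 'rV[R]_n := phi \o gamma in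
  exists v : R -> 'rV[R]_n,
    [/\ {within `[0, +oo[, continuous c},
        {within `[0, +oo[, continuous v},
        forall t : R, 0 < t -> is_derive t 1 c (v t),
        forall t : R, 0 < t -> is_derive t 1 v
          (- \row_k \sum_(i < n) \sum_(j < n)
               christoffel g k i j (c t) * v t 0 i * v t 0 j)
      & forall t : R, 0 <= t -> inner g (c t) (v t) (v t) = 1].

Definition dist_to_set (R : realType) (M : Type) (d : M -> M -> R)
    (x : M) (G : set M) : R :=
  inf [set d x y | y in G].

Definition is_projection (R : realType) (M : Type) (d : M -> M -> R)
    (G : set M) (x y : M) : Prop :=
  G y /\ d x y = dist_to_set d x G.

Definition unique_projection (R : realType) (M : Type) (d : M -> M -> R)
    (G : set M) : Prop :=
  forall x, ~ G x -> exists! y, is_projection d G x y.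

Definition open_horobowl (R : realType) (M : Type) (d : M -> M -> R)
    (gamma : R -> M) : set M :=
  \bigcup_(t in [set t : R | 0 < t]) [set y | d (gamma t) y < t].

(* For complete metrics of nonpositive curvature there is exactly one ray gamma
   from y = pi(x) through x (up to its irrelevant values at t < 0). *)
Definition weakly_convex (R : realType) (n : nat) (M : Type)
    (phi : M -> 'rV[R]_n) (g : 'rV[R]_n -> 'M[R]_n) (G : set M) : Prop :=
  let d := riemannian_dist phi g in
  unique_projection d G /\
  forall x y, ~ G x -> is_projection d G x y ->
    exists gamma : R -> M,
      [/\ unit_speed_geodesic_ray phi g gamma,
          gamma 0 = y,
          exists2 t : R, 0 <= t & gamma t = x
        & open_horobowl d gamma `&` G = set0].

Definition deformation_retract (R : realType) (M : topologicalType)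
    (G : set M) : Prop :=
  exists H : M * R -> M,
    [/\ {within [set: M] `*` `[0, 1], continuous H},
        forall x, H (x, 0) = x,
        forall x, G (H (x, 1))
      & forall x (t : R), G x -> 0 <= t <= 1 -> H (x, t) = x].

(* Main.v *)
(** Let f = d(., G).  Outside G, weak convexity makes f grow at unit speed along
   the ray c from pi(x) through x, also beyond x.  Let x' be close to x, with ray
   c'.  Going back from x' along c' and forward from x along c, f changes at unit
   speed, so the path made of these two pieces is almost minimizing; if their
   velocities at x' and x differed, a straight chord in the chart would cut the
   corner and be shorter.  Hence these velocities are close, and by Gronwall's
   inequality for the geodesic equation, solved backwards from x', so are the whole
   geodesics down to G.  The homotopy H(x, s) = c((1 - s) f(x)) is therefore
   continuous outside G; near a point of G it is continuous because f(x') bounds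
   the length of the path followed by x'.  Throughout, d is only ever bounded from
   above, by lengths of straight chords in the chart. *)

Require Import Defs.
From HB Require Import structures.
From mathcomp Require Import all_boot all_order all_algebra.
From mathcomp Require Import all_classical all_reals all_analysis.
From mathcomp Require Import ring lra.

Import Order.TTheory GRing.Theory Num.Theory.
Import numFieldNormedType.Exports.

Local Open Scope classical_set_scope.
Local Open Scope ring_scope.

Set Implicit Arguments.
Unset Strict Implicit.
Unset Printing Implicit Defensive.

(** * Functions that are Lipschitz on every ball *)

(** Neither the foot points pi(x) nor the velocities there are known in advance to depend
    continuously on x, so neighbouring rays are first compared at x and x' themselves. There
    calibration, [f (c t) = t], controls f from both sides: from below by the horobowl condition,
    from above by inscribed polygons.

    Corner cutting rests on a tie between two scales. A corner of size e saves a length of order e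
    times the squared velocity gap, while Taylor remainders, the change of the metric and the
    displacement of x' together cost O(e^2) once x' is within e^2 of x. So e is fixed first and the
    neighbourhood of x afterwards.

    Constants must be uniform over balls of the chart, because c' is only known to pass near c.
    [ball_lipschitz] provides them: it is stable under the algebra that builds the Christoffel
    symbols, and yields bounds, continuity and Lipschitz constants alike. The chart carries the sup
    norm, so the mean value theorem can be used coordinate by coordinate. In the chart estimates the
    distance to G is any function subject to [f_segment]. *)

Definition ball_lipschitz (R : realType) (V : normedModType R) (f : V -> R) :=
  forall rho : R, exists2 L : R, 0 <= L &
    forall x y, `|x| <= rho -> `|y| <= rho -> `|f x - f y| <= L * `|x - y|.

Section BallLipschitz.
Variables (R : realType) (V : normedModType R).
Implicit Types f h : V -> R.

Lemma ball_lipschitz_bounded f : ball_lipschitz f ->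
  forall rho : R, exists2 K : R, 0 <= K & forall x, `|x| <= rho -> `|f x| <= K.
Proof.
(* With [|rho|] as radius, the comparison point 0 lies in the ball even when [rho] is negative. *)
move=> fL rho; have [L L0 fLr] := fL `|rho|.
exists (`|f 0| + L * `|rho|); first by rewrite addr_ge0// mulr_ge0.
move=> x xr; rewrite -[f x](subrK (f 0)) addrC.
have xr' : `|x| <= `|rho| by rewrite (le_trans xr)// ler_norm.
rewrite (le_trans (ler_normD _ _))// lerD2l.
by rewrite (le_trans (fLr _ _ xr' _)) ?normr0// subr0 ler_wpM2l.
Qed.

Lemma ball_lipschitz_cst a : ball_lipschitz (fun _ : V => a).
Proof. by move=> rho; exists 0 => // x y _ _; rewrite subrr normr0 mul0r. Qed.

Lemma ball_lipschitzD f h : ball_lipschitz f -> ball_lipschitz h ->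
  ball_lipschitz (fun x => f x + h x).
Proof.
move=> fL hL rho; have [L L0 HL] := fL rho; have [K K0 HK] := hL rho.
exists (L + K); first exact: addr_ge0.
move=> x y xr yr; rewrite opprD addrACA mulrDl (le_trans (ler_normD _ _))//.
by rewrite lerD ?HL ?HK.
Qed.

Lemma ball_lipschitzN f : ball_lipschitz f -> ball_lipschitz (fun x => - f x).
Proof.
move=> fL rho; have [L L0 HL] := fL rho; exists L => // x y xr yr.
by rewrite -opprD normrN HL.
Qed.

Lemma ball_lipschitzB f h : ball_lipschitz f -> ball_lipschitz h ->
  ball_lipschitz (fun x => f x - h x).
Proof. by move=> fL hL; apply: ball_lipschitzD => //; exact: ball_lipschitzN. Qed.

Lemma ball_lipschitzM f h : ball_lipschitz f -> ball_lipschitz h ->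
  ball_lipschitz (fun x => f x * h x).
Proof.
move=> fL hL rho; have [L L0 HL] := fL rho; have [K K0 HK] := hL rho.
have [A A0 HA] := ball_lipschitz_bounded fL rho.
have [B B0 HB] := ball_lipschitz_bounded hL rho.
exists (A * K + B * L); first by rewrite addr_ge0// mulr_ge0.
move=> x y xr yr.
have -> : f x * h x - f y * h y = f x * (h x - h y) + h y * (f x - f y) by ring.
rewrite (le_trans (ler_normD _ _))// mulrDl !normrM -!mulrA.
by rewrite lerD// ler_pM ?HA ?HB ?HL ?HK.
Qed.

Lemma ball_lipschitz_sum (I : Type) (s : seq I) (P : pred I) (F : I -> V -> R) :
  (forall i, ball_lipschitz (F i)) ->
  ball_lipschitz (fun x => \sum_(i <- s | P i) F i x).
Proof.
move=> FL; elim: s => [|i s IH].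
  by under eq_fun do rewrite big_nil; exact: ball_lipschitz_cst.
under eq_fun do rewrite big_cons; case: (P i) => //.
exact: ball_lipschitzD.
Qed.

Lemma ball_lipschitz_prod (I : Type) (s : seq I) (P : pred I) (F : I -> V -> R) :
  (forall i, ball_lipschitz (F i)) ->
  ball_lipschitz (fun x => \prod_(i <- s | P i) F i x).
Proof.
move=> FL; elim: s => [|i s IH].
  by under eq_fun do rewrite big_nil; exact: ball_lipschitz_cst.
under eq_fun do rewrite big_cons; case: (P i) => //.
exact: ball_lipschitzM.
Qed.

Lemma ball_lipschitzV f : ball_lipschitz f ->
  (forall rho : R, exists2 m : R, 0 < m & forall x, `|x| <= rho -> m <= `|f x|) ->
  ball_lipschitz (fun x => (f x)^-1).
Proof.
move=> fL fm rho; have [L L0 HL] := fL rho; have [m m0 Hm] := fm rho.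
exists (L / m ^+ 2); first by rewrite divr_ge0// exprn_ge0// ltW.
move=> x y xr yr; have fx := Hm _ xr; have fy := Hm _ yr.
have fx0 : f x != 0 by rewrite -normr_gt0 (lt_le_trans m0).
have fy0 : f y != 0 by rewrite -normr_gt0 (lt_le_trans m0).
have -> : (f x)^-1 - (f y)^-1 = (f y - f x) / (f x * f y) by field; apply/andP.
rewrite normrM normfV normrM distrC [leRHS]mulrAC; apply: ler_pM; rewrite ?HL ?invr_ge0 ?mulr_ge0//.
by rewrite lef_pV2 ?posrE ?mulr_gt0 ?exprn_gt0 ?normr_gt0// expr2 ler_pM// ltW.
Qed.

Lemma ball_lipschitz_continuous f : ball_lipschitz f -> continuous f.
Proof.
move=> fL x; have [L L0 HL] := fL (`|x| + 1).
apply/cvgrPdist_lt => e e0.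
have d0 : 0 < Num.min 1 (e / (L + 1)).
  by rewrite lt_min ltr01 divr_gt0// ltr_wpDl.
near=> y; have xy : `|x - y| < Num.min 1 (e / (L + 1)).
  by near: y; apply: cvgr_dist_lt.
move: xy; rewrite lt_min => /andP[xy1 xy2].
have /le_lt_trans -> // : `|f x - f y| <= L * `|x - y|.
  rewrite HL ?lerDl// -[y](subrK x) addrC (le_trans (ler_normD _ _))//.
  by rewrite lerD2l distrC ltW.
rewrite (@le_lt_trans _ _ ((L + 1) * `|x - y|))// ?ler_wpM2r ?lerDl//.
by rewrite mulrC -ltr_pdivlMr// ltr_wpDl.
Unshelve. all: by end_near. Qed.

Lemma ball_lipschitz_comp (W : normedModType R) (p : W -> V) f :
  ball_lipschitz f -> (forall x, `|p x| <= `|x|) ->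
  (forall x y, `|p x - p y| <= `|x - y|) -> ball_lipschitz (f \o p).
Proof.
move=> fL p1 p2 rho; have [L L0 HL] := fL rho; exists L => // x y xr yr /=.
by rewrite (le_trans (HL _ _ _ _)) ?ler_wpM2l ?(le_trans (p1 _)).
Qed.

End BallLipschitz.

Lemma ball_lipschitz_fst (R : realType) (V W : normedModType R) (f : V -> R) :
  ball_lipschitz f -> ball_lipschitz (fun z : V * W => f z.1).
Proof.
move=> fL; apply: (ball_lipschitz_comp fL) => [x|x y].
  by rewrite [`|x|]/Num.norm/= le_max lexx.
by rewrite [leRHS]/Num.norm/= le_max lexx.
Qed.

Lemma ball_lipschitz_snd (R : realType) (V W : normedModType R) (f : W -> R) :
  ball_lipschitz f -> ball_lipschitz (fun z : V * W => f z.2).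
Proof.
move=> fL; apply: (ball_lipschitz_comp fL) => [x|x y].
  by rewrite [`|x|]/Num.norm/= le_max lexx orbT.
by rewrite [leRHS]/Num.norm/= le_max lexx orbT.
Qed.

Lemma positive_compact_lower_bound (R : realType) (T : topologicalType)
    (A : set T) (f : T -> R) : compact A -> continuous f ->
  (forall x, A x -> 0 < f x) -> exists2 m, 0 < m & forall x, A x -> m <= f x.
Proof.
move=> cA cf fpos; have [A0|/set0P/negP/negPn/eqP A0] := pselect (A !=set0).
  have [c cA' Hc] := compact_EVT_min A0 cA (continuous_subspaceT cf).
  exists (f c); first by apply: fpos; exact/set_mem.
  by move=> x Ax; apply: Hc; exact/mem_set.
(* Empty set, for instance a ball of negative radius: any positive constant serves. *)
by exists 1 => // x; rewrite A0.
Qed.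

(** * Sup norm and mean value estimates on row vectors *)

Section RowVectors.
Variables (R : realType) (n : nat).
Implicit Types x y z : 'rV[R]_n.

Lemma rV_norm_le x (r : R) : 0 <= r -> (`|x| <= r <-> forall i, `|x 0 i| <= r).
Proof.
move=> r0; rewrite [`|x|]/Num.norm/= mx_normrE; split=> [xr i|xr].
  apply: le_trans xr.
  by rewrite (le_bigmax _ (fun ij : 'I_1 * 'I_n => `|x ij.1 ij.2|) (0, i)).
by apply: bigmax_le => // -[i j] _ /=; rewrite ord1.
Qed.

Lemma rV_coord_le x i : `|x 0 i| <= `|x|.
Proof. by have /rV_norm_le/(_ i) := lexx `|x|; exact. Qed.

Lemma ball_lipschitz_coord i : ball_lipschitz (fun x => x 0 i).
Proof.
move=> rho; exists 1 => // x y _ _; rewrite mul1r.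
by have := rV_coord_le (x - y) i; rewrite !mxE.
Qed.

Lemma compact_closed_ball_rV (r : R) : compact [set x : 'rV[R]_n | `|x| <= r].
Proof.
apply: bounded_closed_compact.
  by exists r; split; rewrite ?num_real// => s rs x /= xr; rewrite (le_trans xr)// ltW.
apply: (@preimage_closed _ _ (fun x : 'rV[R]_n => `|x|) [set s | s <= r]).
  by move=> x _; exact: norm_continuous.
exact: closed_le.
Qed.

Lemma continuous_ball_bounded (f : 'rV[R]_n -> R) : continuous f ->
  forall rho : R, exists2 K : R, 0 <= K & forall x, `|x| <= rho -> `|f x| <= K.
Proof.
move=> cf rho.
have : compact (f @` [set x : 'rV[R]_n | `|x| <= rho]).
  apply: continuous_compact; last exact: compact_closed_ball_rV.
  exact: continuous_subspaceT.
move=> /compact_bounded[M [_ HM]]; exists (`|M| + 1); first exact: addr_ge0.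
move=> x xr; apply: HM; last by exists x.
by rewrite (le_lt_trans (ler_norm _))// ltrDl.
Qed.

(** Mean value theorem on the line through [x] in direction [i]. Each coordinate of the intermediate
    point lies between those of the endpoints, so it stays in the sup-norm ball where [K]
    applies. *)
Lemma coordinate_increment (f : 'rV[R]_n -> R) i (rho K : R) x (h : R) :
  (forall z, derivable f z (delta_mx 0 i)) ->
  (forall z, `|z| <= rho -> `|partial i f z| <= K) ->
  `|x| <= rho -> `|x + h *: delta_mx 0 i| <= rho ->
  `|f (x + h *: delta_mx 0 i) - f x| <= K * `|h|.
Proof.
move=> df fK.
have K0 : `|x| <= rho -> 0 <= K by move=> /fK; exact: le_trans.
wlog h0 : x h K0 / 0 <= h.
  move=> wl xr xhr; have [h0|/ltW h0] := leP 0 h; first exact: wl.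
  rewrite distrC -[X in f X](addrK (h *: delta_mx 0 i)) -scaleNr -[`|h|]normrN.
  apply: wl; rewrite ?oppr_ge0//; last by rewrite scaleNr addrK.
  by move=> /fK; exact: le_trans.
move=> xr xhr.
pose p s := f (x + s *: delta_mx 0 i).
have dp (s : R) : is_derive s 1 p (partial i f (x + s *: delta_mx 0 i)).
  have eqq : (fun h => h^-1 *: ((p \o shift s) (h *: (1 : R)) - p s)) =
     (fun h => h^-1 *: ((f \o shift (x + s *: delta_mx 0 i)) (h *: delta_mx 0 i)
        - f (x + s *: delta_mx 0 i))).
    apply/funext => u /=; rewrite /p; congr (_ *: (f _ - _)).
    by rewrite scalerDl -[u%:A]/(u * 1) mulr1 addrCA.
  have := df (x + s *: delta_mx 0 i).
  split; first by rewrite /derivable eqq.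
  by rewrite /partial /derive eqq.
have [|c cin] := MVT_segment h0 (fun s _ => dp s).
  apply: derivable_within_continuous => s _; exact: ex_derive.
rewrite /p scale0r addr0 subr0 => ->.
rewrite normrM ler_wpM2r// fK//.
have r0 : 0 <= rho by rewrite (le_trans _ xr).
apply/rV_norm_le => // j.
move/rV_norm_le : xr => /(_ r0 j); move/rV_norm_le : xhr => /(_ r0 j).
rewrite !mxE eqxx /=; case: eqP => _; rewrite ?mulr0 ?addr0// !mulr1.
move: cin; rewrite in_itv/= => /andP[c0 ch]; rewrite !ler_norml.
move=> /andP[? ?] /andP[? ?]; apply/andP; split; lra.
Qed.

(* In the sup norm, changing x into y one coordinate at a time stays in the
   ball. *)
Lemma C1_ball_lipschitz (f : 'rV[R]_n -> R) :
  (forall i, continuous (partial i f)) ->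
  (forall i z, derivable f z (delta_mx 0 i)) -> ball_lipschitz f.
Proof.
move=> cf df rho.
have /choice[K HK] : forall i : 'I_n, exists k : R, 0 <= k /\
    forall x, `|x| <= rho -> `|partial i f x| <= k.
  by move=> i; have [k k0 Hk] := continuous_ball_bounded (cf i) rho; exists k.
exists (\sum_i K i); first by apply: sumr_ge0 => i _; case: (HK i).
move=> x y xr yr.
have r0 : 0 <= rho by rewrite (le_trans _ xr).
pose z (k : nat) := \row_(i < n) (if (i < k)%N then x 0 i else y 0 i).
have zr k : `|z k| <= rho.
  apply/rV_norm_le => // i; rewrite mxE.
  by case: ifP => _; rewrite (le_trans (rV_coord_le _ _)).
have zS (k : 'I_n) : z k.+1 = z k + (x 0 k - y 0 k) *: delta_mx 0 k.
  apply/rowP => i; rewrite !mxE eqxx/= ltnS leq_eqVlt.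
  have -> : (i == k :> nat) = (i == k) by [].
  by case: eqP => [->|_]/=; rewrite ?ltnn ?mulr1 ?mulr0 ?addr0// addrC subrK.
have -> : f x - f y = \sum_(k < n) (f (z k.+1) - f (z k)).
  rewrite -(big_mkord xpredT (fun k => f (z k.+1) - f (z k))) telescope_sumr//.
  congr (f _ - f _); apply/rowP => i; rewrite mxE ?ltn_ord//.
rewrite (le_trans (ler_norm_sum _ _ _))// mulr_suml ler_sum// => k _.
have [Kk0 HKk] := HK k.
rewrite zS (le_trans (coordinate_increment _ HKk _ _)) -?zS//.
by rewrite ler_wpM2l//; have := rV_coord_le (x - y) k; rewrite !mxE.
Qed.

End RowVectors.

Lemma smooth_ball_lipschitz (R : realType) n (f : 'rV[R]_n -> R) :
  smooth f -> ball_lipschitz f.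
Proof.
move=> sf; apply: C1_ball_lipschitz => [i|i z].
  by have [] := sf [:: i].
by have [_] := sf [::]; exact.
Qed.

Lemma smooth_partial (R : realType) n (f : 'rV[R]_n -> R) i :
  smooth f -> smooth (partial i f).
Proof. by move=> sf s; have := sf (rcons s i); rewrite foldr_rcons. Qed.

(** * The metric in the chart *)

Section Metric.
Variables (R : realType) (n : nat) (g : 'rV[R]_n -> 'M[R]_n).
Hypothesis Hg : riemannian_metric g.
Implicit Types x y u v w : 'rV[R]_n.

Let gsym x : (g x)^T = g x. Proof. by case: Hg. Qed.
Let gpos x v : v != 0 -> 0 < inner g x v v. Proof. by case: Hg => _ _; exact. Qed.

Lemma innerE x u v : inner g x u v = \sum_i \sum_j g x i j * (u 0 i * v 0 j).
Proof.
rewrite /inner mxE exchange_big/=; apply: eq_bigr => j _.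
rewrite mxE mulr_suml; apply: eq_bigr => i _; rewrite mxE; ring.
Qed.

Lemma innerC x u v : inner g x u v = inner g x v u.
Proof.
have -> : inner g x u v = (u *m g x *m v^T)^T 0 0 by rewrite [RHS]mxE.
by rewrite !trmx_mul trmxK gsym mulmxA.
Qed.

Lemma innerDl x u v w : inner g x (u + v) w = inner g x u w + inner g x v w.
Proof. by rewrite /inner !mulmxDl mxE. Qed.

Lemma innerZl x a u w : inner g x (a *: u) w = a * inner g x u w.
Proof. by rewrite /inner -!scalemxAl mxE. Qed.

Lemma innerDr x u v w : inner g x w (u + v) = inner g x w u + inner g x w v.
Proof. by rewrite innerC innerDl !(innerC x w). Qed.

Lemma innerZr x a u w : inner g x w (a *: u) = a * inner g x w u.
Proof. by rewrite innerC innerZl innerC. Qed.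

Lemma inner_ge0 x v : 0 <= inner g x v v.
Proof.
have [->|v0] := eqVneq v 0; last exact/ltW/gpos.
by rewrite /inner !mul0mx mxE.
Qed.

Definition gnorm x v := Num.sqrt (inner g x v v).

Lemma gnorm_ge0 x v : 0 <= gnorm x v.
Proof. exact: sqrtr_ge0. Qed.

Lemma gnorm_sqr x v : gnorm x v ^+ 2 = inner g x v v.
Proof. by rewrite sqr_sqrtr// inner_ge0. Qed.

Lemma gnormZ x a v : gnorm x (a *: v) = `|a| * gnorm x v.
Proof. by rewrite /gnorm innerZl innerZr mulrA -expr2 sqrtrM ?sqr_ge0// sqrtr_sqr. Qed.

Lemma gnormN x v : gnorm x (- v) = gnorm x v.
Proof. by rewrite -scaleN1r gnormZ normrN normr1 mul1r. Qed.

(** Cauchy-Schwarz: positivity at [<v, v> u - <u, v> v], which is [<v, v>] times the part of [u]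
    orthogonal to [v]. *)
Lemma inner_gnorm_le x u v : inner g x u v <= gnorm x u * gnorm x v.
Proof.
have [->|v0] := eqVneq v 0.
  by rewrite innerC {1}/inner !mul0mx mxE mulr_ge0// gnorm_ge0.
have B0 := gpos x v0; rewrite -gnorm_sqr in B0.
have := inner_ge0 x (inner g x v v *: u - inner g x u v *: v).
rewrite -scaleNr !(innerDl, innerDr, innerZl, innerZr) (innerC x v u).
rewrite -!gnorm_sqr; set C := inner g x u v; set a := gnorm x u.
move: B0; set b := gnorm x v => B0.
have a0 : 0 <= a by exact: gnorm_ge0.
have b0 : 0 <= b by exact: gnorm_ge0.
rewrite [leRHS](_ : _ = b ^+ 2 * ((a * b) ^+ 2 - C ^+ 2)); last by ring.
rewrite pmulr_rge0// subr_ge0 => H.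
rewrite (le_trans (ler_norm C))// -ler_sqr ?nnegrE ?mulr_ge0//.
by rewrite real_normK// num_real.
Qed.

Lemma gnormD x u v : gnorm x (u + v) <= gnorm x u + gnorm x v.
Proof.
rewrite -ler_sqr ?nnegrE ?addr_ge0 ?gnorm_ge0// sqrrD !gnorm_sqr.
rewrite innerDl !innerDr (innerC x v u).
have := inner_gnorm_le x u v; lra.
Qed.

Lemma gnorm_parallelogram x u v :
  gnorm x (u - v) ^+ 2 + gnorm x (u + v) ^+ 2 =
  (gnorm x u ^+ 2 + gnorm x v ^+ 2) *+ 2.
Proof.
rewrite !gnorm_sqr -scaleN1r !(innerDl, innerDr, innerZl, innerZr); ring.
Qed.

Lemma ball_lipschitz_metric i j : ball_lipschitz (fun x => g x i j).
Proof. by apply: smooth_ball_lipschitz; case: Hg => ? _ _. Qed.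

Lemma rV_coord_mul_le u v i j : `|u 0 i * v 0 j| <= `|u| * `|v|.
Proof. by rewrite normrM ler_pM// rV_coord_le. Qed.

Lemma inner_lipschitz (rho : R) : exists2 L : R, 0 <= L & forall x y w,
  `|x| <= rho -> `|y| <= rho ->
  `|inner g x w w - inner g y w w| <= L * `|x - y| * `|w| ^+ 2.
Proof.
have /choice[L HL] : forall ij : 'I_n * 'I_n, exists L : R, 0 <= L /\
    forall x y, `|x| <= rho -> `|y| <= rho ->
    `|g x ij.1 ij.2 - g y ij.1 ij.2| <= L * `|x - y|.
  move=> [i j]; have [L L0 HL] := ball_lipschitz_metric i j rho.
  by exists L.
exists (\sum_i \sum_j L (i, j)).
  by apply: sumr_ge0 => i _; apply: sumr_ge0 => j _; case: (HL (i, j)).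
move=> x y w xr yr; rewrite !innerE -sumrB -mulrA mulr_suml.
rewrite (le_trans (ler_norm_sum _ _ _))// ler_sum// => i _.
rewrite -sumrB mulr_suml (le_trans (ler_norm_sum _ _ _))// ler_sum// => j _.
rewrite -mulrBl normrM mulrA expr2 ler_pM ?rV_coord_mul_le//.
by case: (HL (i, j)) => _; exact.
Qed.

Lemma gnorm_upper (rho : R) : exists2 K : R, 0 <= K & forall x w,
  `|x| <= rho -> gnorm x w <= K * `|w|.
Proof.
have /choice[L HL] : forall ij : 'I_n * 'I_n, exists L : R, 0 <= L /\
    forall x, `|x| <= rho -> `|g x ij.1 ij.2| <= L.
  move=> [i j].
  have [L L0 HL] := ball_lipschitz_bounded (ball_lipschitz_metric i j) rho.
  by exists L.
(* The added 1 gives [K <= (1 + K) ^+ 2] for the double sum [K], so the constant needs no square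
   root. *)
exists (1 + \sum_i \sum_j L (i, j)).
  apply: addr_ge0 => //; apply: sumr_ge0 => i _.
  by apply: sumr_ge0 => j _; case: (HL (i, j)).
move=> x w xr.
set K := \sum_i _.
have K0 : 0 <= K.
  by apply: sumr_ge0 => i _; apply: sumr_ge0 => j _; case: (HL (i, j)).
have H : inner g x w w <= K * `|w| ^+ 2.
  rewrite (le_trans (ler_norm _))// innerE mulr_suml.
  rewrite (le_trans (ler_norm_sum _ _ _))// ler_sum// => i _.
  rewrite mulr_suml (le_trans (ler_norm_sum _ _ _))// ler_sum// => j _.
  rewrite normrM expr2 ler_pM ?rV_coord_mul_le//.
  by case: (HL (i, j)) => _; exact.
rewrite -ler_sqr ?nnegrE ?gnorm_ge0 ?mulr_ge0 ?addr_ge0// gnorm_sqr exprMn.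
by rewrite (le_trans H)// ler_wpM2r ?sqr_ge0//; nra.
Qed.

(** The metric has a positive minimum on the compact product of the ball and the unit sphere;
    homogeneity in [w] extends the bound to all vectors. *)
Lemma gnorm_lower (rho : R) : exists2 m : R, 0 < m & forall x w,
  `|x| <= rho -> m * `|w| <= gnorm x w.
Proof.
pose h (z : 'rV[R]_n * 'rV[R]_n) := inner g z.1 z.2 z.2.
have hL : ball_lipschitz h.
  have -> : h = fun z => \sum_i \sum_j g z.1 i j * (z.2 0 i * z.2 0 j).
    by apply/funext => z; exact: innerE.
  apply: ball_lipschitz_sum => i; apply: ball_lipschitz_sum => j.
  apply: ball_lipschitzM.
    apply: (@ball_lipschitz_fst _ _ _ (fun x => g x i j)).
    exact: ball_lipschitz_metric.
  by apply: ball_lipschitzM; apply: (@ball_lipschitz_snd _ _ _ (fun x => x 0 _));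
    exact: ball_lipschitz_coord.
have cS : compact [set w : 'rV[R]_n | `|w| = 1].
  apply: (subclosed_compact _ (@compact_closed_ball_rV R n 1)); last first.
    by move=> w /= ->.
  apply: (@preimage_closed _ _ (fun w : 'rV[R]_n => `|w|) [set s | s = 1]).
    by move=> w _; exact: norm_continuous.
  exact: closed_eq.
have [|m m0 Hm] := positive_compact_lower_bound
    (compact_setX (@compact_closed_ball_rV R n rho) cS)
    (ball_lipschitz_continuous hL).
  move=> [x w] [/= _ w1]; apply: gpos.
  by apply/eqP => /= w0; move: w1; rewrite w0 normr0 => /eqP; rewrite eq_sym oner_eq0.
exists (Num.sqrt m); first by rewrite sqrtr_gt0.
move=> x w xr; have [->|w0] := eqVneq w 0.
  by rewrite normr0 mulr0 gnorm_ge0.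
have w0' : 0 < `|w| by rewrite normr_gt0.
have : m <= h (x, `|w|^-1 *: w).
  by apply: Hm; split=> //=; rewrite normrZ normfV normr_id mulVf// gt_eqF.
rewrite -ler_sqrt; last exact: inner_ge0.
rewrite -/(gnorm _ _) gnormZ normfV normr_id => H.
by rewrite mulrC -ler_pdivlMl.
Qed.

Lemma metric_det_neq0 x : \det (g x) != 0.
Proof.
apply/det0P => -[v v0 vg]; have := gpos x v0.
by rewrite /inner vg mul0mx mxE ltxx.
Qed.

Lemma ball_lipschitz_det m (A : 'rV[R]_n -> 'M[R]_m) :
  (forall i j, ball_lipschitz (fun x => A x i j)) ->
  ball_lipschitz (fun x => \det (A x)).
Proof.
move=> AL; apply: ball_lipschitz_sum => s; apply: ball_lipschitzM.
  exact: ball_lipschitz_cst.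
by apply: ball_lipschitz_prod => i.
Qed.

(** Cramer's rule: cofactors are determinants, hence Lipschitz on balls, and compactness keeps the
    determinant of the metric away from 0 there. *)
Lemma ball_lipschitz_invmx k l : ball_lipschitz (fun x => invmx (g x) k l).
Proof.
have dL := ball_lipschitz_det ball_lipschitz_metric.
under eq_fun => x.
  rewrite /invmx unitmxE unitfE metric_det_neq0 /= !mxE /cofactor.
  over.
apply: ball_lipschitzM.
  apply: ball_lipschitzV => // rho.
  have [||m m0 Hm] := @positive_compact_lower_bound R _ _ (fun x => `|\det (g x)|)
    (@compact_closed_ball_rV R n rho).
  - move=> x; apply: (@continuous_comp _ _ _ (fun x => \det (g x)) Num.norm).
      exact: ball_lipschitz_continuous.
    exact: norm_continuous.
  - by move=> x _; rewrite normr_gt0 metric_det_neq0.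
  by exists m => // x xr; exact: Hm.
apply: ball_lipschitzM; first exact: ball_lipschitz_cst.
apply: ball_lipschitz_det => i j; under eq_fun do rewrite !mxE.
exact: ball_lipschitz_metric.
Qed.

Lemma ball_lipschitz_christoffel k i j : ball_lipschitz (christoffel g k i j).
Proof.
have pL a b c : ball_lipschitz (partial a (fun y => g y b c)).
  by apply/smooth_ball_lipschitz/smooth_partial; case: Hg => ? _ _.
apply: ball_lipschitzM; first exact: ball_lipschitz_cst.
apply: ball_lipschitz_sum => l; apply: ball_lipschitzM.
  exact: ball_lipschitz_invmx.
apply: ball_lipschitzB; first exact: ball_lipschitzD.
exact: pL.
Qed.

End Metric.

(** * The Riemannian distance and straight chords *)

Section Distance.
Variables (R : realType) (n : nat) (g : 'rV[R]_n -> 'M[R]_n).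
Hypothesis Hg : riemannian_metric g.
Implicit Types p q w : 'rV[R]_n.

Lemma curve_length_ge0 c : 0 <= curve_length g c.
Proof. by apply: Rintegral_ge0 => t _; exact: sqrtr_ge0. Qed.

Lemma joined_by_ge0 p q L : joined_by g p q L -> 0 <= L.
Proof. by elim=> // c q' L' _ _ L0; rewrite addr_ge0// curve_length_ge0. Qed.

Lemma joined_by_cat p q z L L' :
  joined_by g p q L -> joined_by g q z L' -> joined_by g p z (L + L').
Proof.
elim=> [p'|c q' l c1 _ IH] qz; first by rewrite add0r.
by rewrite -addrA; apply: joined_cons => //; exact: IH.
Qed.

Lemma is_derive_segment p w (t : R) : is_derive t 1 (fun s => p + s *: w) w.
Proof.
pose c (s : R) := p + s *: w.
have H : h^-1 *: ((c \o shift t) (h *: (1 : R)) - c t) @[h --> (0 : R)^'] --> w.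
  apply: cvg_near_cst; near=> h.
  rewrite /c /= -[h%:A]/(h * 1) mulr1 scalerDl opprD addrACA subrr add0r addrK.
  by rewrite scalerA mulVf ?scale1r//; near: h; exact: nbhs_dnbhs_neq.
by split; [exact: cvgP H | exact: cvg_lim H].
Unshelve. all: by end_near. Qed.

(** The length is the integral of the speed over a parameter interval of length 1, so a pointwise
    bound on the speed bounds it. *)
Lemma joined_by_segment p q (B : R) :
  (forall t, 0 <= t <= 1 -> gnorm g (p + t *: (q - p)) (q - p) <= B) ->
  exists2 L, joined_by g p q L & L <= B.
Proof.
move=> HB; pose c (t : R) := p + t *: (q - p).
have dc (t : R) : is_derive t 1 c (q - p) by exact: is_derive_segment.
have dc1 : derive1 c = cst (q - p).
  by apply/funext => t; rewrite derive1E derive_val.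
have cC1 : C1_curve c.
  split; first by move=> t; exact: ex_derive.
  by rewrite dc1; exact: cst_continuous.
have c1 : c 1 = q by rewrite /c scale1r addrC subrK.
have c0 : c 0 = p by rewrite /c scale0r addr0.
exists (curve_length g c + 0).
  rewrite -{1}c0; apply: joined_cons => //; rewrite c1; exact: joined_nil.
rewrite addr0 /curve_length.
have cg : continuous (fun t => gnorm g (c t) (q - p)).
  move=> t; apply: (@continuous_comp _ _ _ (fun t => inner g (c t) (q - p) (q - p))).
    apply: (@continuous_comp _ _ _ c (fun x => inner g x (q - p) (q - p))).
      by apply/differentiable_continuous/derivable1_diffP; exact: ex_derive.
    apply: ball_lipschitz_continuous.
    under eq_fun do rewrite innerE.
    apply: ball_lipschitz_sum => i; apply: ball_lipschitz_sum => j.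
    apply: ball_lipschitzM; first exact: ball_lipschitz_metric.
    exact: ball_lipschitz_cst.
  exact: sqrt_continuous.
have -> : B = \int[lebesgue_measure]_(t in `[(0:R), 1]) B.
  rewrite Rintegral_cst; last exact: measurable_itv.
  have := lebesgue_measure_itv `[(0 : R), 1].
  rewrite /= lte_fin ltr01 oppr0 adde0 => H.
  by rewrite [X in fine X]H /= mulr1.
apply: le_Rintegral => //.
- apply: continuous_compact_integrable; first exact: segment_compact.
  rewrite dc1; exact: continuous_subspaceT.
- apply: continuous_compact_integrable; first exact: segment_compact.
  by apply: continuous_subspaceT; exact: cst_continuous.
- by move=> t /=; rewrite in_itv/= => t01; rewrite dc1; exact: HB.
Qed.

Variables (M : Type) (phi : M -> 'rV[R]_n).
Local Notation d := (riemannian_dist phi g).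

Let lengths_lb p q : has_lbound [set L | joined_by g p q L].
Proof. by exists 0 => L; exact: joined_by_ge0. Qed.

(** The infimum of an empty set of lengths would be a mere default value; the straight segment of
    the chart rules this out. *)
Let lengths_nonempty p q : [set L | joined_by g p q L] !=set0.
Proof.
have [K K0 HK] := gnorm_upper Hg (`|p| + `|q - p|).
have [|L HL _] := @joined_by_segment p q (K * `|q - p|); last by exists L.
move=> t /andP[t0 t1]; apply: HK; rewrite (le_trans (ler_normD _ _))// lerD2l.
by rewrite normrZ ger0_norm// ler_piMl.
Qed.

Lemma riemannian_dist_ge0 x y : 0 <= d x y.
Proof. by apply: lb_le_inf => // L; exact: joined_by_ge0. Qed.

Lemma riemannian_distxx x : d x x = 0.
Proof.
apply/eqP; rewrite eq_le riemannian_dist_ge0 andbT.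
by apply: ge_inf => //; exact: joined_nil.
Qed.

(** The chord is prepended to an arbitrary path from [y] to [z], and the infimum is taken over these
    paths. *)
Lemma riemannian_dist_triangle x y z (B : R) :
  (forall t, 0 <= t <= 1 ->
     gnorm g (phi x + t *: (phi y - phi x)) (phi y - phi x) <= B) ->
  d x z <= d y z + B.
Proof.
move=> /joined_by_segment[L xyL LB]; rewrite -lerBlDr.
apply: lb_le_inf => // L' yzL'; rewrite lerBlDr (@le_trans _ _ (L + L'))//.
  by apply: ge_inf => //; exact: joined_by_cat xyL yzL'.
by rewrite addrC lerD2l.
Qed.

(** Source of the hypothesis [f_segment] of the later sections. *)
Lemma dist_to_set_segment (G : set M) x y (B : R) : G !=set0 ->
  (forall t, 0 <= t <= 1 ->
     gnorm g (phi x + t *: (phi y - phi x)) (phi y - phi x) <= B) ->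
  dist_to_set d x G <= dist_to_set d y G + B.
Proof.
move=> G0 HB; rewrite -lerBlDr; apply: lb_le_inf.
  by have [z Gz] := G0; exists (d y z); exists z.
move=> _ [z Gz <-]; rewrite lerBlDr.
apply: le_trans (riemannian_dist_triangle z HB); apply: ge_inf; last by exists z.
by exists 0 => _ [z' _ <-]; exact: riemannian_dist_ge0.
Qed.

Lemma dist_to_set_le0 (G : set M) x : G x -> dist_to_set d x G <= 0.
Proof.
move=> Gx; rewrite -(riemannian_distxx x); apply: ge_inf; last by exists x.
by exists 0 => _ [z' _ <-]; exact: riemannian_dist_ge0.
Qed.

End Distance.

(** * Geodesics *)

Lemma within_continuous_comp (R : realType) (W : topologicalType) (A B : set R)
    (p : R -> R) (c : R -> W) : continuous p -> (forall s, A s -> B (p s)) ->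
  {within B, continuous c} -> {within A, continuous (c \o p)}.
Proof.
move=> cp AB /subspace_continuousP cB; apply/subspace_continuousP => s As.
apply: cvg_comp (cB _ (AB _ As)) => U BU.
have := cp s _ BU; apply: (@filterS _ (nbhs s)) => x /= H Ax; exact/H/AB.
Qed.

(** Continuous induction. At the infimum of the times with [b <= h s] the hypothesis applies, so [h]
    is below [b] there and, by continuity, shortly afterwards, where bad times should accumulate. *)
Lemma confinement (R : realType) (h : R -> R) (b T : R) :
  {within `[0, T], continuous h} ->
  (forall t, 0 <= t <= T -> (forall s, 0 <= s < t -> h s <= b) -> h t < b) ->
  forall t, 0 <= t <= T -> h t < b.
Proof.
move=> /subspace_continuousP ch H t /andP[t0 tT]; rewrite ltNge; apply/negP => ht.
pose A := [set s | 0 <= s <= T /\ b <= h s].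
have At : A t by split; rewrite ?t0.
have lbA : has_lbound A by exists 0 => s [/andP[]].
have A0 : A !=set0 by exists t.
have m0 : 0 <= inf A by apply: (@lb_le_inf _ A) => // s [/andP[]].
have mt : inf A <= t by exact: (@ge_inf _ A).
have mT : 0 <= inf A <= T by rewrite m0 (le_trans mt).
have hm : h (inf A) < b.
  apply: H => // s /andP[s0 sm]; rewrite leNgt; apply/negP => hs.
  have : inf A <= s.
    apply: (@ge_inf _ A) => //; split; last exact: ltW.
    by rewrite s0/= (le_trans (ltW sm))//; case/andP: mT.
  by rewrite leNgt sm.
have hm' : 0 < b - h (inf A) by rewrite subr_gt0.
have /ch /cvgrPdist_lt/(_ _ hm') : `[0, T]%classic (inf A) by rewrite /= in_itv.
rewrite near_withinE => -[d /= d0 Hd].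
have [s As sm] := inf_adherent d0 (conj A0 lbA).
have ms : inf A <= s by exact: (@ge_inf _ A).
have [sT hs] := As.
have : `|h (inf A) - h s| < b - h (inf A).
  apply: Hd; last by rewrite /= in_itv.
  by rewrite /ball/= distrC ger0_norm ?subr_ge0// ltrBlDl.
by rewrite distrC ltr_norml => /andP[_]; lra.
Qed.

Lemma is_derive_coord (R : realType) n (t : R) (c : R -> 'rV[R]_n) (u : 'rV[R]_n) i :
  is_derive t 1 c u -> is_derive t 1 (fun s => c s 0 i) (u 0 i).
Proof.
move=> [dc cu]; split; first by have /derivable_mxP := dc; exact.
by rewrite -cu derive_mx// mxE.
Qed.

Lemma within_continuous_coord (R : realType) n (A : set R) (c : R -> 'rV[R]_n) i :
  {within A, continuous c} -> {within A, continuous (fun s => c s 0 i)}.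
Proof.
move=> cc s; apply: (@continuous_comp _ _ _ (c : subspace A -> _) (fun x => x 0 i)).
  exact: cc.
exact: coord_continuous.
Qed.

Lemma within_continuous_sum (R : realType) (A : set R) (I : Type) (r : seq I)
    (F : I -> R -> R) : (forall i, {within A, continuous (F i)}) ->
  {within A, continuous (fun s => \sum_(i <- r) F i s)}.
Proof.
move=> cF; elim: r => [|i r IH].
  by under eq_fun do rewrite big_nil; move=> s; exact: cvg_cst.
under eq_fun do rewrite big_cons.
by move=> s; apply: continuousD; [exact: cF|exact: IH].
Qed.

Lemma within_continuous_distance (R : realType) n (A : set R) (c d : R -> 'rV[R]_n) :
  {within A, continuous c} -> {within A, continuous d} ->
  {within A, continuous (fun s => `|c s - d s|)}.
Proof.
move=> /subspace_continuousP cc /subspace_continuousP cd.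
apply/subspace_continuousP => s As.
by apply: cvg_norm; apply: cvgB; [exact: cc|exact: cd].
Qed.

(** The intermediate time of the mean value theorem varies with the coordinate, but the bound [K] is
    uniform in time, and the sup norm then costs no dimensional constant. *)
Lemma rV_increment (R : realType) n (c dc : R -> 'rV[R]_n) (a b K : R)
    (u : 'rV[R]_n) : a <= b -> 0 <= K -> {within `[a, b], continuous c} ->
  (forall t i, a < t < b -> is_derive t 1 (fun s => c s 0 i) (dc t 0 i)) ->
  (forall t, a < t < b -> `|dc t - u| <= K) ->
  `|c b - c a - (b - a) *: u| <= K * (b - a).
Proof.
move=> ab K0 cc dcE dcK; apply/rV_norm_le => [|i]; first by rewrite mulr_ge0// subr_ge0.
move: ab; rewrite le_eqVlt => /predU1P[<-|ab].
  by rewrite !mxE !subrr mul0r subr0 normr0 mulr0.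
have dci t : t \in `]a, b[ -> is_derive t 1 (fun s => c s 0 i) (dc t 0 i).
  by rewrite in_itv/= => tab; exact: dcE.
have [s] := MVT ab dci (within_continuous_coord (i := i) cc).
rewrite in_itv/= => sab; rewrite !mxE => ->.
have -> : dc s 0 i * (b - a) - (b - a) * u 0 i = (dc s - u) 0 i * (b - a).
  by rewrite !mxE; ring.
rewrite normrM [`|b - a|]ger0_norm ?subr_ge0 ?(ltW ab)// ler_wpM2r ?subr_ge0 ?(ltW ab)//.
by rewrite (le_trans (rV_coord_le _ _))// dcK.
Qed.

Section Geodesics.
Variables (R : realType) (n : nat) (g : 'rV[R]_n -> 'M[R]_n).
Hypothesis Hg : riemannian_metric g.
Implicit Types (p u : 'rV[R]_n) (c v : R -> 'rV[R]_n).

Definition geodesic_acc p u : 'rV[R]_n :=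
  - \row_k \sum_(i < n) \sum_(j < n) christoffel g k i j p * u 0 i * u 0 j.

(** The acceleration is quadratic in the velocity; this is what makes a reversed geodesic a
    geodesic. *)
Lemma geodesic_accN p u : geodesic_acc p (- u) = geodesic_acc p u.
Proof.
congr (- _); apply/rowP => k; rewrite !mxE; apply: eq_bigr => i _.
by apply: eq_bigr => j _; rewrite !mxE; ring.
Qed.

Lemma ball_lipschitz_acc k :
  ball_lipschitz (fun z : 'rV[R]_n * 'rV[R]_n => geodesic_acc z.1 z.2 0 k).
Proof.
have -> : (fun z : 'rV[R]_n * 'rV[R]_n => geodesic_acc z.1 z.2 0 k) =
    fun z => - \sum_i \sum_j christoffel g k i j z.1 * z.2 0 i * z.2 0 j.
  by apply/funext => z; rewrite !mxE.
apply: ball_lipschitzN; apply: ball_lipschitz_sum => i.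
apply: ball_lipschitz_sum => j.
apply: ball_lipschitzM; last first.
  exact: (@ball_lipschitz_snd R 'rV[R]_n _ _ (ball_lipschitz_coord j)).
apply: ball_lipschitzM; last first.
  exact: (@ball_lipschitz_snd R 'rV[R]_n _ _ (ball_lipschitz_coord i)).
exact: (@ball_lipschitz_fst R _ 'rV[R]_n _ (ball_lipschitz_christoffel Hg k i j)).
Qed.

Lemma geodesic_acc_bounded (rho : R) : exists2 K : R, 0 <= K & forall p u,
  `|p| <= rho -> `|u| <= rho -> `|geodesic_acc p u| <= K.
Proof.
have /choice[K HK] : forall k : 'I_n, exists K : R, 0 <= K /\
    forall z : 'rV[R]_n * 'rV[R]_n, `|z| <= rho -> `|geodesic_acc z.1 z.2 0 k| <= K.
  move=> k; have [K K0 HK] := ball_lipschitz_bounded (ball_lipschitz_acc k) rho.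
  by exists K.
exists (\sum_k K k); first by apply: sumr_ge0 => k _; case: (HK k).
move=> p u pr ur; apply/rV_norm_le => [|k].
  by apply: sumr_ge0 => k _; case: (HK k).
rewrite (bigD1 k)//= ler_wpDr//; first by apply: sumr_ge0 => j _; case: (HK j).
by case: (HK k) => _ /(_ (p, u)); apply; rewrite [`|_|]/Num.norm/= ge_max pr.
Qed.

Lemma geodesic_acc_lipschitz (rho : R) : exists2 L : R, 0 <= L &
  forall p u q w k, `|p| <= rho -> `|u| <= rho -> `|q| <= rho -> `|w| <= rho ->
  `|geodesic_acc p u 0 k - geodesic_acc q w 0 k| <= L * Num.max `|p - q| `|u - w|.
Proof.
have /choice[L HL] : forall k : 'I_n, exists L : R, 0 <= L /\
    forall x y : 'rV[R]_n * 'rV[R]_n, `|x| <= rho -> `|y| <= rho ->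
    `|geodesic_acc x.1 x.2 0 k - geodesic_acc y.1 y.2 0 k| <= L * `|x - y|.
  by move=> k; have [L L0 HL] := ball_lipschitz_acc k rho; exists L.
exists (\sum_k L k); first by apply: sumr_ge0 => k _; case: (HL k).
move=> p u q w k pr ur qr wr.
have [_ /(_ (p, u) (q, w)) H] := HL k.
apply: (le_trans (H _ _)); rewrite ?[`|(_, _)|]/Num.norm/= ?ge_max ?pr ?qr//.
rewrite ler_wpM2r ?le_max ?normr_ge0//.
by rewrite (bigD1 k)//= ler_wpDr//; apply: sumr_ge0 => j _; case: (HL j).
Qed.

(** Differentiability is asked on the open interval only, so that a ray run backwards down to its
    origin, where it is merely continuous from one side, still qualifies. *)
Definition geodesic_segment (T : R) c v :=
  [/\ {within `[0, T], continuous c},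
      {within `[0, T], continuous v},
      forall t i, 0 < t < T -> is_derive t 1 (fun s => c s 0 i) (v t 0 i),
      forall t i, 0 < t < T ->
        is_derive t 1 (fun s => v s 0 i) (geodesic_acc (c t) (v t) 0 i)
    & forall t, 0 <= t <= T -> inner g (c t) (v t) (v t) = 1].

Lemma unit_velocity_bound (rho : R) : exists2 B : R, 0 <= B & forall p u,
  `|p| <= rho -> inner g p u u = 1 -> `|u| <= B.
Proof.
have [m m0 Hm] := gnorm_lower Hg rho.
exists m^-1; first by rewrite invr_ge0 ltW.
move=> p u pr u1; have := Hm p u pr; rewrite /gnorm u1 sqrtr1.
by rewrite -ler_pdivlMl// mulr1.
Qed.

(** Taylor expansion with constants that depend on [rho] alone. The bounds on velocity and
    acceleration hold only inside the ball of radius [rho + 1], so the segment must first be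
    confined to it. *)
Lemma geodesic_segment_expansion (rho : R) :
  exists tau A : R, [/\ 0 < tau, 0 <= A & forall T c v, T <= tau ->
    geodesic_segment T c v -> `|c 0| <= rho -> forall s, 0 <= s <= T ->
    [/\ `|c s| <= rho + 1, `|v s| <= A, `|c s - c 0| <= A * s
      & `|c s - c 0 - s *: v 0| <= A * s ^+ 2]].
Proof.
have [B B0 HB] := unit_velocity_bound (rho + 1).
have [A A0 HA] := geodesic_acc_bounded (Num.max (rho + 1) B).
(* At chart speed at most [B], a time [(B + 1)^-1] is too short to travel distance 1. The sum
   [A + B] serves as a common constant for first and second order. *)
exists (B + 1)^-1, (A + B); split; rewrite ?addr_ge0 ?invr_gt0 ?ltr_wpDl//.
move=> T c v Ttau [cc cv dc dv n1] c0.
have near0 t : `|c t - c 0| <= 1 -> `|c t| <= rho + 1.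
  move=> ct; rewrite -[c t](subrK (c 0)) addrC.
  by rewrite (le_trans (ler_normD _ _))// lerD.
have drift t : 0 <= t <= T -> (forall s, 0 <= s < t -> `|c s - c 0| <= 1) ->
    `|c t - c 0| <= B * t.
  move=> /andP[t0 tT] Ht.
  have := @rV_increment _ _ c v 0 t B 0 t0 B0.
  rewrite scaler0 !subr0; apply.
  - apply: continuous_subspaceW cc => s /=; rewrite !in_itv/= => /andP[-> st].
    exact: le_trans st tT.
  - by move=> s i /andP[s0 st]; apply: dc; rewrite s0 (lt_le_trans st).
  - move=> s /andP[s0 st]; rewrite subr0; apply: (HB (c s)).
      by apply/near0/Ht; rewrite (ltW s0).
    by apply: n1; rewrite (ltW s0) (le_trans (ltW st)).
have conf t : 0 <= t <= T -> `|c t - c 0| < 1.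
  apply: (@confinement _ (fun t => `|c t - c 0|) 1) => [|s sT Hs].
    apply: within_continuous_distance cc _.
    by move=> s; exact: cvg_cst.
  rewrite (le_lt_trans (drift _ sT Hs))//; case/andP: sT => s0 sT.
  have sB : s <= (B + 1)^-1 by exact: le_trans sT Ttau.
  have B1 : 0 < B + 1 by rewrite ltr_wpDl.
  rewrite (@le_lt_trans _ _ (B * (B + 1)^-1)) ?ler_wpM2l//.
  by rewrite -ltr_pdivlMr ?invr_gt0// invrK mul1r ltrDl.
have inB t : 0 <= t <= T -> `|c t| <= rho + 1 by move=> /conf/ltW/near0.
have vB t : 0 <= t <= T -> `|v t| <= B.
  by move=> tT; apply: (HB (c t)); [exact: inB|exact: n1].
have aA t : 0 <= t <= T -> `|geodesic_acc (c t) (v t)| <= A.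
  by move=> tT; apply: HA; rewrite le_max ?inB ?vB ?orbT.
have vdrift t : 0 <= t <= T -> `|v t - v 0| <= A * t.
  move=> /andP[t0 tT].
  have := @rV_increment _ _ v (fun s => geodesic_acc (c s) (v s)) 0 t A 0 t0 A0.
  rewrite scaler0 !subr0; apply.
  - apply: continuous_subspaceW cv => s /=; rewrite !in_itv/= => /andP[-> st].
    exact: le_trans st tT.
  - by move=> s i /andP[s0 st]; apply: dv; rewrite s0 (lt_le_trans st).
  - by move=> s /andP[s0 st]; rewrite subr0 aA// (ltW s0) (le_trans (ltW st)).
move=> s sT; have [s0 sT'] := andP sT; split.
- exact: inB.
- by rewrite (le_trans (vB _ sT))// ler_wpDl.
- rewrite (le_trans (drift _ sT _)) ?ler_wpM2r ?ler_wpDl//.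
  by move=> r /andP[r0 rs]; apply/ltW/conf; rewrite r0 (le_trans (ltW rs)).
(* On [[0, s]] the velocity differs from [v 0] by at most [A * s]; integrating once more contributes
   the second factor [s]. *)
- have As0 : 0 <= A * s by rewrite mulr_ge0.
  have := @rV_increment _ _ c v 0 s (A * s) (v 0) s0 As0; rewrite subr0 => H.
  rewrite (le_trans (H _ _ _)).
  + by [].
  + apply: continuous_subspaceW cc => r /=; rewrite !in_itv/= => /andP[-> st].
    exact: le_trans st sT'.
  + by move=> r i /andP[r0 rs]; apply: dc; rewrite r0 (lt_le_trans rs).
  + move=> r /andP[r0 rs]; rewrite (le_trans (vdrift _ _))//.
      by rewrite (ltW r0) (le_trans (ltW rs)).
    by rewrite ler_wpM2l// ltW.
  + by rewrite -mulrA -expr2 ler_wpM2r ?sqr_ge0// lerDl.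
Qed.

End Geodesics.

(** The product [expR (- k * t) * E t] has nonpositive derivative, so one use of the mean value
    theorem suffices; [T = 0] is split off because that theorem needs a proper interval. *)
Lemma gronwall (R : realType) (E dE : R -> R) (k T : R) : 0 <= T ->
  {within `[0, T], continuous E} ->
  (forall t, 0 < t < T -> is_derive t 1 E (dE t)) ->
  (forall t, 0 < t < T -> dE t <= k * E t) -> E T <= expR (k * T) * E 0.
Proof.
rewrite le_eqVlt => /predU1P[<-|T0] cE HE dEk; first by rewrite mulr0 expR0 mul1r.
pose p t := expR (- k * t).
have dlin (t : R) : is_derive t 1 ( *%R (- k)) (- k).
  apply: (is_derive_eq (is_deriveZ (- k) (is_derive_id t 1))).
  exact: mulr1.
have dp (t : R) : is_derive t 1 p (p t * - k).
  exact: (is_derive1_comp (is_derive_expR (- k * t)) (dlin t)).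
have dpE t : t \in `]0, T[ -> is_derive t 1 (p * E) (p t *: dE t + E t *: (p t * - k)).
  by rewrite in_itv/= => tT; apply: is_deriveM; exact: HE.
have cp : continuous p.
  by move=> t; apply/differentiable_continuous/derivable1_diffP; exact: ex_derive.
have cpE : {within `[0, T], continuous (p * E)}.
  move=> t; apply: continuousM; last exact: cE.
  exact: (continuous_subspaceT cp).
have [t] := MVT T0 dpE cpE; rewrite in_itv/= => tT.
have -> : (p * E) T - (p * E) 0 = p T * E T - E 0.
  by rewrite -[(p * E) 0]/(p 0 * E 0) [in p 0]/p mulr0 expR0 mul1r.
have pt : 0 < p t by exact: expR_gt0.
have -> : p t *: dE t + E t *: (p t * - k) = p t * (dE t - k * E t).
  by rewrite /GRing.scale/=; ring.
move=> H; have : p T * E T <= E 0.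
  rewrite -subr_le0 H subr0 pmulr_lle0// pmulr_rle0// subr_le0; exact: dEk.
by rewrite /p mulNr expRN ler_pdivrMl ?expR_gt0.
Qed.

(** Collects smallness conditions: [e * b < a] with [a > 0] is entered as the constant [b / a], and
    one [e] then meets a whole list of them. *)
Lemma exists_small (R : realType) (s : seq R) :
  exists2 e : R, 0 < e & forall c, c \in s -> e * c < 1.
Proof.
elim: s => [|a s [e e0 He]]; first by exists 1.
exists (Num.min e (`|a| + 1)^-1); first by rewrite lt_min e0 invr_gt0 ltr_wpDl.
move=> c; rewrite inE => /predU1P[->|cs].
  have [a0|a0] := leP a 0.
    by rewrite (le_lt_trans _ ltr01)// mulr_ge0_le0// le_min ltW//= invr_ge0 addr_ge0.
  rewrite (@le_lt_trans _ _ ((`|a| + 1)^-1 * a))//.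
    by rewrite ler_wpM2r ?(ltW a0)// ge_min lexx orbT.
  by rewrite mulrC ltr_pdivrMr ?ltr_wpDl// mul1r gtr0_norm// ltrDl.
have [c0|c0] := leP c 0.
  by rewrite (le_lt_trans _ ltr01)// mulr_ge0_le0// le_min ltW//= invr_ge0 addr_ge0.
rewrite (le_lt_trans _ (He c cs))// ler_wpM2r ?(ltW c0)//.
by rewrite ge_min lexx.
Qed.

Lemma rV_norm_sqr_le (R : realType) n (w : 'rV[R]_n) :
  `|w| ^+ 2 <= \sum_i w 0 i ^+ 2.
Proof.
have S0 : 0 <= \sum_i w 0 i ^+ 2 by apply: sumr_ge0 => i _; exact: sqr_ge0.
rewrite -[leRHS]sqr_sqrtr// ler_sqr ?nnegrE ?sqrtr_ge0//.
apply/rV_norm_le => [|i]; first exact: sqrtr_ge0.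
rewrite -sqrtr_sqr ler_sqrt// (bigD1 i)//= lerDl.
by apply: sumr_ge0 => j _; exact: sqr_ge0.
Qed.

Lemma norm_convex (R : realType) n (a b : 'rV[R]_n) (t D : R) : 0 <= t <= 1 ->
  `|a| <= D -> `|b| <= D -> `|a + t *: (b - a)| <= D.
Proof.
move=> /andP[t0 t1] aD bD.
have -> : a + t *: (b - a) = (1 - t) *: a + t *: b.
  by apply/rowP => i; rewrite !mxE; ring.
rewrite (le_trans (ler_normD _ _))// !normrZ !ger0_norm ?subr_ge0//.
have -> : D = (1 - t) * D + t * D by ring.
by rewrite lerD// ler_wpM2l ?subr_ge0.
Qed.

(** * Rays, their forward and reversed pieces, and continuous dependence *)

Section Rays.
Variables (R : realType) (n : nat) (g : 'rV[R]_n -> 'M[R]_n).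
Hypothesis Hg : riemannian_metric g.
Implicit Types (p q b w : 'rV[R]_n) (c v : R -> 'rV[R]_n).

(** The squared norm is Lipschitz in the base point with constant [L]. Taking [K = L / m], with [m]
    the lower bound of [gnorm], lets the cross term of the squared right-hand side absorb that
    variation. *)
Lemma gnorm_base_change (rho : R) : exists2 K : R, 0 <= K & forall p b w,
  `|p| <= rho -> `|b| <= rho -> gnorm g p w <= gnorm g b w + K * `|p - b| * `|w|.
Proof.
have [L L0 HL] := inner_lipschitz Hg rho; have [m m0 Hm] := gnorm_lower Hg rho.
exists (L / m); first by rewrite divr_ge0// ltW.
move=> p b w pr br.
have K0 : 0 <= L / m * `|p - b| * `|w| by rewrite !mulr_ge0// invr_ge0 ltW.
rewrite -ler_sqr ?nnegrE ?addr_ge0 ?gnorm_ge0// sqrrD !gnorm_sqr//.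
have H1 : inner g p w w - inner g b w w <= L * `|p - b| * `|w| ^+ 2.
  by rewrite (le_trans (ler_norm _))// HL.
have H2 : m * `|w| * (L / m * `|p - b| * `|w|) <=
    gnorm g b w * (L / m * `|p - b| * `|w|) by rewrite ler_wpM2r// Hm.
have H3 : m * `|w| * (L / m * `|p - b| * `|w|) = L * `|p - b| * `|w| ^+ 2.
  by field; rewrite gt_eqF.
rewrite H3 in H2.
have H4 : 0 <= (L / m * `|p - b| * `|w|) ^+ 2 by exact: sqr_ge0.
have H5 : 0 <= L * `|p - b| * `|w| ^+ 2 by rewrite !mulr_ge0// exprn_ge0.
rewrite -mulr_natr; nra.
Qed.

(** The content of [unit_speed_geodesic_ray] with the velocity as an argument, since velocities of
    different rays are to be compared. *)
Definition geodesic_ray c v :=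
  [/\ {within `[0, +oo[, continuous c},
      {within `[0, +oo[, continuous v},
      forall t : R, 0 < t -> is_derive t 1 c (v t),
      forall t : R, 0 < t -> is_derive t 1 v (geodesic_acc g (c t) (v t))
    & forall t : R, 0 <= t -> inner g (c t) (v t) (v t) = 1].

Lemma geodesic_ray_forward c v (r T : R) : 0 <= r -> geodesic_ray c v ->
  geodesic_segment g T (fun s => c (r + s)) (fun s => v (r + s)).
Proof.
move=> r0 [cc cv dc dv n1].
have cs : continuous (fun s : R => r + s).
  by move=> s; apply: cvgD; [exact: cvg_cst|exact: cvg_id].
have ds (s : R) : is_derive s 1 (fun s => r + s) 1.
  have := is_deriveD (is_derive_cst r s 1) (is_derive_id s 1).
  by rewrite add0r.
split.
- apply: within_continuous_comp cs _ cc => s /=; rewrite !in_itv/= andbT.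
  by move=> /andP[s0 _]; rewrite addr_ge0.
- apply: within_continuous_comp cs _ cv => s /=; rewrite !in_itv/= andbT.
  by move=> /andP[s0 _]; rewrite addr_ge0.
- move=> t i /andP[t0 _].
  have := is_derive1_comp (is_derive_coord i (dc _ (ltr_wpDl r0 t0))) (ds t).
  by rewrite mulr1.
- move=> t i /andP[t0 _].
  have := is_derive1_comp (is_derive_coord i (dv _ (ltr_wpDl r0 t0))) (ds t).
  by rewrite mulr1.
- by move=> t /andP[t0 _]; rewrite n1// addr_ge0.
Qed.

Lemma geodesic_ray_backward c v (r T : R) : T <= r -> geodesic_ray c v ->
  geodesic_segment g T (fun s => c (r - s)) (fun s => - v (r - s)).
Proof.
move=> Tr [cc cv dc dv n1].
have cs : continuous (fun s : R => r - s).
  by move=> s; apply: cvgB; [exact: cvg_cst|exact: cvg_id].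
have ds (s : R) : is_derive s 1 (fun s => r - s) (- 1).
  have := is_deriveB (is_derive_cst r s 1) (is_derive_id s 1).
  by rewrite sub0r.
have pos (t : R) : t < T -> 0 < r - t by move=> tT; rewrite subr_gt0 (lt_le_trans tT).
split.
- apply: within_continuous_comp cs _ cc => s /=; rewrite !in_itv/= andbT.
  by move=> /andP[_ sT]; rewrite subr_ge0 (le_trans sT).
- have : {within `[0, T], continuous (fun s => v (r - s))}.
    apply: within_continuous_comp cs _ cv => s /=; rewrite !in_itv/= andbT.
    by move=> /andP[_ sT]; rewrite subr_ge0 (le_trans sT).
  by move=> cv' s; apply: continuousN; exact: cv'.
- move=> t i /andP[_ /pos tT].
  have := @is_derive1_comp _ (fun s => c s 0 i) (fun s => r - s) _ _ _
    (is_derive_coord i (dc _ tT)) (ds t).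
  by rewrite mulrN1 mxE.
- move=> t i /andP[_ /pos tT].
  have := @is_derive1_comp _ (fun s => v s 0 i) (fun s => r - s) _ _ _
    (is_derive_coord i (dv _ tT)) (ds t).
  rewrite mulrN1 geodesic_accN => /is_deriveN; rewrite opprK.
  by under [in X in _ -> X]eq_fun do rewrite mxE.
- move=> t /andP[_ tT]; rewrite /= -(scaleN1r (v (r - t))) innerZl innerZr//.
  by rewrite n1 ?subr_ge0 ?(le_trans tT)// mulrA mulrNN !mulr1.
Qed.

(** Gronwall's inequality for [E], the squared Euclidean distance in the chart between the states
    (position, velocity). [S] may be smaller than [T] because a neighbouring ray can reach its
    origin sooner. *)
Lemma geodesic_dependence (T eta : R) c v : 0 <= T -> 0 < eta ->
  geodesic_segment g T c v -> exists2 delta : R, 0 < delta &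
  forall (S : R) c' v', S <= T -> geodesic_segment g S c' v' ->
    `|c' 0 - c 0| < delta -> `|v' 0 - v 0| < delta ->
    forall t, 0 <= t <= S -> `|c' t - c t| < eta.
Proof.
move=> T0 eta0 cT; have [cc cv dc dv n1] := cT.
have [rho Hrho] : exists rho, forall t, 0 <= t <= T -> `|c t| <= rho.
  have c0 : {within `[0, T], continuous (fun=> 0 : 'rV[R]_n)}.
    by move=> s; exact: cvg_cst.
  have [x _ Hx] := EVT_max T0 (within_continuous_distance cc c0).
  exists `|c x - 0| => t tT; have := Hx t; rewrite in_itv/= subr0; exact.
have [B B0 HB] := unit_velocity_bound Hg (rho + 1).
have [L L0 HL] := geodesic_acc_lipschitz Hg (Num.max (rho + 1) B).
pose k : R := 1 + n%:R * (2 * L).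
have k0 : 0 <= k by rewrite addr_ge0// !mulr_ge0.
(* Data within [delta] at time 0 give [E 0 <= 2 n delta ^ 2], so later squared distances are at most
   [X delta ^ 2]; [delta = e1 / (1 + X)] puts this below [e1 ^ 2]. *)
pose X := expR (k * T) * (n%:R * 2).
have X0 : 0 <= X by rewrite !mulr_ge0// expR_ge0.
pose e1 := Num.min eta 1.
have e10 : 0 < e1 by rewrite lt_min eta0 ltr01.
exists (e1 / (1 + X)); first by rewrite divr_gt0// ltr_wpDr.
move=> S c' v' ST [cc' cv' dc' dv' n1'] c0 v0 t tS.
suff : `|c' t - c t| < e1 by rewrite lt_min => /andP[].
(* The constant [L] applies to [c'] only while it stays within 1 of [c]; confinement at level
   [e1 <= 1] breaks this circle. *)
move: t tS; apply: confinement.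
  apply: within_continuous_distance cc' _; apply: continuous_subspaceW cc.
  by move=> s /=; rewrite !in_itv/= => /andP[-> /le_trans]; exact.
move=> t tS Ht; have [t0 tS'] := andP tS.
pose E s := \sum_(i < n) ((c' s 0 i - c s 0 i) ^+ 2 + (v' s 0 i - v s 0 i) ^+ 2).
pose dE s := \sum_(i < n) (2 * (c' s 0 i - c s 0 i) * (v' s 0 i - v s 0 i) +
  2 * (v' s 0 i - v s 0 i) *
  (geodesic_acc g (c' s) (v' s) 0 i - geodesic_acc g (c s) (v s) 0 i)).
have sub s : 0 < s < t -> [/\ 0 < s < T, 0 < s < S, 0 <= s <= T & 0 <= s <= S].
  by move=> /andP[s0 st]; split; apply/andP; split => //; lra.
have cE s : `|c' s - c s| ^+ 2 <= E s.
  rewrite (le_trans (rV_norm_sqr_le _))// ler_sum// => i _.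
  by rewrite !mxE lerDl sqr_ge0.
have vE s : `|v' s - v s| ^+ 2 <= E s.
  rewrite (le_trans (rV_norm_sqr_le _))// ler_sum// => i _.
  by rewrite !mxE lerDr sqr_ge0.
have /gronwall : 0 <= t by [].
move=> /(_ E dE k) H.
have {}H : E t <= expR (k * t) * E 0.
  apply: H.
  - have sub' : [/\ `[0, t] `<=` `[0, T] & `[0, t] `<=` `[0, S]].
      by split=> s /=; rewrite !in_itv/= => /andP[-> st]/=; lra.
    have [subT subS] := sub'.
    have cS (a b : R -> 'rV[R]_n) i : {within `[0, t], continuous a} ->
        {within `[0, t], continuous b} ->
        {within `[0, t], continuous (fun s => (a s 0 i - b s 0 i) ^+ 2)}.
      move=> ca cb; pose f : R -> R := (fun s => a s 0 i) - (fun s => b s 0 i).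
      have -> : (fun s => (a s 0 i - b s 0 i) ^+ 2) = f * f.
        by apply/funext => s; rewrite expr2.
      have cf : {within `[0, t], continuous f}.
        move=> s; apply: continuousB;
          by [exact: within_continuous_coord ca s|exact: within_continuous_coord cb s].
      by move=> s; apply: continuousM; exact: cf.
    apply: within_continuous_sum => i.
    apply: (within_continuousD (f := fun s => (c' s 0 i - c s 0 i) ^+ 2)
      (g := fun s => (v' s 0 i - v s 0 i) ^+ 2)).
      by apply: cS; [exact: continuous_subspaceW cc'|exact: continuous_subspaceW cc].
    by apply: cS; [exact: continuous_subspaceW cv'|exact: continuous_subspaceW cv].
  - move=> s /sub[sT sS sT' sS'].
    pose h i s := (c' s 0 i - c s 0 i) ^+ 2 + (v' s 0 i - v s 0 i) ^+ 2.
    have -> : E = \sum_(i < n) h i by apply/funext => r; rewrite fct_sumE.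
    apply: is_derive_sum => i.
    have d1 := is_deriveX 2 (is_deriveB (dc' s i sS) (dc s i sT)).
    have d2 := is_deriveX 2 (is_deriveB (dv' s i sS) (dv s i sT)).
    apply: is_derive_eq (is_deriveD d1 d2) _.
    by rewrite /= !expr1.
  - move=> s sI; have [sT sS sT' sS'] := sub s sI.
    have cb : `|c s| <= rho + 1 by rewrite (le_trans (Hrho _ sT'))// lerDl.
    have cb' : `|c' s| <= rho + 1.
      rewrite -[c' s](subrK (c s)) (le_trans (ler_normD _ _))// addrC lerD ?Hrho//.
      have : e1 <= 1 by rewrite ge_min lexx orbT.
      by apply: le_trans; apply: Ht; case/andP: sI => /ltW ->.
    have vb : `|v s| <= B by apply: (HB (c s)) => //; exact: n1.
    have vb' : `|v' s| <= B by apply: (HB (c' s)) => //; exact: n1'.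
    set e := Num.max `|c' s - c s| `|v' s - v s|.
    have eE : e ^+ 2 <= E s by rewrite /e; case: (leP `|c' s - c s| `|v' s - v s|).
    have e0 : 0 <= e by rewrite le_max normr_ge0.
    (* The summand 1 of [k] pays for the position terms through [2 a b <= a ^ 2 + b ^ 2]; the other
       pays for the acceleration terms, at most [2 L e ^ 2] in each coordinate. *)
    rewrite mulrDl mul1r /dE big_split/= lerD//.
      by apply: ler_sum => i _; have := sqr_ge0 (c' s 0 i - c s 0 i - (v' s 0 i - v s 0 i)); lra.
    rewrite (@le_trans _ _ (\sum_(i < n) 2 * L * e ^+ 2))//; last first.
      rewrite sumr_const card_ord -[leLHS]mulr_natl -[leRHS]mulrA.
      by apply: ler_wpM2l => //; apply: ler_wpM2l => //; rewrite mulr_ge0.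
    apply: ler_sum => i _; rewrite (le_trans (ler_norm _))// !normrM [`|2|]ger0_norm//.
    have vi : `|v' s 0 i - v s 0 i| <= e.
      rewrite le_max; apply/orP; right.
      by have := rV_coord_le (v' s - v s) i; rewrite !mxE.
    have ai := HL (c' s) (v' s) (c s) (v s) i.
    rewrite -!mulrA ler_wpM2l// [leRHS](_ : _ = e * (L * e)); last by ring.
    apply: ler_pM => //.
    by apply: ai; rewrite le_max ?cb ?cb' ?vb ?vb' ?orbT.
have E0 : E 0 <= n%:R * 2 * (e1 / (1 + X)) ^+ 2.
  set d := e1 / (1 + X); have d0 : 0 <= d by rewrite divr_ge0 ?addr_ge0// ltW.
  rewrite (@le_trans _ _ (\sum_(i < n) 2 * d ^+ 2))//; last first.
    by rewrite sumr_const card_ord -[leLHS]mulr_natl mulrA.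
  apply: ler_sum => i _; rewrite mulr_natl mulr2n lerD//.
    rewrite -real_normK ?num_real// ler_sqr ?nnegrE//.
    by have := rV_coord_le (c' 0 - c 0) i; rewrite !mxE => /le_trans; apply; exact: ltW.
  rewrite -real_normK ?num_real// ler_sqr ?nnegrE//.
  by have := rV_coord_le (v' 0 - v 0) i; rewrite !mxE => /le_trans; apply; exact: ltW.
have : `|c' t - c t| ^+ 2 < e1 ^+ 2.
  rewrite (le_lt_trans (cE t))// (le_lt_trans H)//.
  rewrite (@le_lt_trans _ _ (X * (e1 / (1 + X)) ^+ 2))//.
    rewrite /X -mulrA ler_pM ?expR_ge0//.
      by apply: sumr_ge0 => i _; rewrite addr_ge0 ?sqr_ge0.
    by rewrite ler_expR ler_wpM2l//; lra.
  rewrite expr_div_n mulrCA -ltr_pdivlMl ?exprn_gt0// mulVf ?gt_eqF ?exprn_gt0//.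
  rewrite ltr_pdivrMr ?exprn_gt0 ?ltr_wpDr// mul1r; nra.
by rewrite ltr_sqr ?nnegrE// ltW.
Qed.
End Rays.

(** * The distance to G along its rays *)

Section DistanceFunction.
Variables (R : realType) (n : nat) (g : 'rV[R]_n -> 'M[R]_n).
Hypothesis Hg : riemannian_metric g.
Variable f : 'rV[R]_n -> R.
Hypothesis f_segment : forall (p q : 'rV[R]_n) (B : R),
  (forall t, 0 <= t <= 1 -> gnorm g (p + t *: (q - p)) (q - p) <= B) ->
  f p <= f q + B.
Implicit Types (p q b w : 'rV[R]_n) (c v : R -> 'rV[R]_n).

(** The metric is frozen at [b]: along a chord that stays within [D] of [b], this changes the length
    by at most [K * D * |q - p|]. *)
Lemma segment_estimate (rho : R) : exists2 K : R, 0 <= K & forall b p q (D : R),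
  `|b| <= rho -> `|p| <= rho -> `|q| <= rho -> `|p - b| <= D -> `|q - b| <= D ->
  f p <= f q + (gnorm g b (q - p) + K * D * `|q - p|).
Proof.
have [K K0 HK] := gnorm_base_change Hg rho.
exists K => // b p q D br pr qr pD qD; apply: f_segment => t t01.
rewrite (le_trans (HK _ b _ _ br))//; first exact: norm_convex.
rewrite lerD2l ler_wpM2r// ler_wpM2l//.
have -> : p + t *: (q - p) - b = (p - b) + t *: ((q - b) - (p - b)).
  by apply/rowP => i; rewrite !mxE; ring.
exact: norm_convex.
Qed.

Lemma distance_lipschitz (rho : R) : exists2 C : R, 0 <= C & forall p q,
  `|p| <= rho -> `|q| <= rho -> f p <= f q + C * `|p - q|.
Proof.
have [C C0 HC] := gnorm_upper Hg rho; exists C => // p q pr qr.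
apply: f_segment => t t01; rewrite (le_trans (HC _ _ _)) ?[`|q - p|]distrC//.
exact: norm_convex.
Qed.

(** Upper half of calibration. The ray is replaced by inscribed chords, as these are the paths that
    [f_segment] controls. *)
Lemma ray_distance_upper c v (T : R) : geodesic_ray g c v -> 0 <= T ->
  f (c T) <= f (c 0) + T.
Proof.
move=> ray T0.
have [rho Hrho] : exists rho, forall t, 0 <= t <= T -> `|c t| <= rho.
  have [cc _ _ _ _] := ray.
  have cc' : {within `[0, T], continuous c}.
    apply: continuous_subspaceW cc => s /=.
    by rewrite !in_itv/= => /andP[->].
  have c0 : {within `[0, T], continuous (fun=> 0 : 'rV[R]_n)}.
    by move=> s; exact: cvg_cst.
  have [x _ Hx] := EVT_max T0 (within_continuous_distance cc' c0).
  by exists `|c x - 0| => t tT; have := Hx t; rewrite in_itv/= subr0; exact.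
have [tau [A [tau0 A0 HA]]] := geodesic_segment_expansion Hg rho.
have [K K0 HK] := segment_estimate (rho + 1).
have [L L0 HL] := gnorm_upper Hg rho.
(* [L * A] measures the deviation of the chord from [h *: v t], and [K * A ^+ 2] the variation of
   the metric along the chord. *)
pose k := L * A + K * A ^+ 2.
have k0 : 0 <= k by rewrite addr_ge0// mulr_ge0// sqr_ge0.
(* A chord of time step h has length at most h + k h^2; the quadratic errors sum to
   O(1/N) over N steps. *)
have step t h : 0 <= t -> 0 <= h <= tau -> t + h <= T ->
    f (c (t + h)) <= f (c t) + (h + k * h ^+ 2).
  move=> t0 /andP[h0 htau] thT.
  have ct : `|c t| <= rho by apply: Hrho; rewrite t0/= (le_trans _ thT)// lerDl.
  have ct1 : `|c t| <= rho + 1 by rewrite (le_trans ct)// lerDl.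
  have seg := geodesic_ray_forward h t0 ray.
  have := HA h _ _ htau seg; rewrite addr0 => /(_ ct h); rewrite h0 lexx.
  move=> /(_ isT)[cth _ d1 d2].
  have := HK (c t) (c (t + h)) (c t) (A * h) ct1 cth ct1 d1.
  rewrite subrr normr0 mulr_ge0// => /(_ isT) H.
  apply: (le_trans H); rewrite lerD2l distrC.
  have nv : gnorm g (c t) (v t) = 1.
    by have [_ _ _ _ n1] := ray; rewrite /gnorm n1// sqrtr1.
  have H1 : gnorm g (c t) (c t - c (t + h)) <= h + L * (A * h ^+ 2).
    rewrite -opprB gnormN//.
    rewrite -[c (t + h) - c t](subrK (h *: v t)).
    rewrite (le_trans (gnormD Hg _ _ _))// addrC lerD//.
      by rewrite gnormZ// nv mulr1 ger0_norm.
    by rewrite (le_trans (HL _ _ ct))// ler_wpM2l.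
  have H2 : K * (A * h) * `|c (t + h) - c t| <= K * (A * h) * (A * h).
    by rewrite ler_wpM2l// !mulr_ge0.
  have -> : h + k * h ^+ 2 = h + L * (A * h ^+ 2) + K * (A * h) * (A * h).
    by rewrite /k; ring.
  exact: lerD.
apply/ler_addgt0Pr => e e0.
(* The first summand makes the total error [k * T ^+ 2 / N] at most [e], the second makes the step
   [T / N] at most [tau]. *)
pose N := (Num.truncn (k * T ^+ 2 / e + T / tau)).+1.
have N0 : 0 < N%:R :> R by rewrite ltr0n.
have NP : k * T ^+ 2 / e + T / tau < N%:R by rewrite truncnS_gt.
have Q0 : 0 <= k * T ^+ 2 / e by rewrite divr_ge0 ?(ltW e0)// mulr_ge0// sqr_ge0.
have Q1 : 0 <= T / tau by rewrite divr_ge0// ltW.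
pose h := T / N%:R.
have h0 : 0 <= h by rewrite divr_ge0.
have hN : N%:R * h = T by rewrite mulrC divfK// gt_eqF.
have htau : h <= tau.
  rewrite ler_pdivrMr// -ler_pdivrMl// mulrC ltW// (le_lt_trans _ NP)//.
  by rewrite lerDr.
have ind j : (j <= N)%N -> f (c (j%:R * h)) <= f (c 0) + j%:R * (h + k * h ^+ 2).
  elim: j => [_|j IH jN]; first by rewrite !mul0r addr0.
  have jh : j%:R * h + h <= T.
    by rewrite -hN -[X in _ + X]mul1r -mulrDl natr1 ler_wpM2r// ler_nat.
  have -> : j.+1%:R * h = j%:R * h + h by rewrite -natr1; ring.
  rewrite (le_trans (step _ _ _ _ jh)) ?mulr_ge0 ?h0//.
  have -> : j.+1%:R * (h + k * h ^+ 2) = j%:R * (h + k * h ^+ 2) + (h + k * h ^+ 2).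
    by rewrite -natr1; ring.
  rewrite [leRHS]addrA lerD2r; exact/IH/ltnW.
have := ind N (leqnn N); rewrite hN => /le_trans; apply.
rewrite -addrA lerD2l mulrDr hN lerD2l.
have -> : N%:R * (k * h ^+ 2) = k * T ^+ 2 / N%:R by rewrite /h; field; rewrite gt_eqF.
rewrite ler_pdivrMr// -ler_pdivrMl// mulrC ltW// (le_lt_trans _ NP)//.
by rewrite lerDl.
Qed.

(** Calibration also recovers the parameter from the point, [r = f (c r)], so nearby points on two
    rays have nearby parameters. *)
Definition calibrated_ray c v :=
  geodesic_ray g c v /\ forall t, 0 <= t -> f (c t) = t.

(* Corner cutting: f drops by 2e - O(e^2) from p = c(r + e) to q = c'(r' - e), while
   the chord from p to q has length e |v r + v' r'| + O(e^2); the parallelogram law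
   then makes v r - v' r' small. *)
Lemma calibrated_velocity_continuous c v (r eta : R) :
  calibrated_ray c v -> 0 < r -> 0 < eta -> exists2 delta : R, 0 < delta &
  forall c' v' (r' : R), calibrated_ray c' v' -> 0 <= r' ->
    `|c' r' - c r| < delta -> `|v' r' - v r| < eta.
Proof.
move=> [ray fc] r0 eta0.
set x := c r; pose rho := `|x| + 1.
have [tau [A [tau0 A0 HA]]] := geodesic_segment_expansion Hg rho.
have [K K0 HK] := segment_estimate (rho + 1).
have [L L0 HL] := gnorm_upper Hg (rho + 1).
have [K2 K20 HK2] := gnorm_base_change Hg (rho + 1).
have [C C0 HC] := distance_lipschitz (rho + 1).
have [m m0 Hm] := gnorm_lower Hg (rho + 1).
(* The costs of order [e ^+ 2]: [C] for the difference between [r'] and [r], [L * (2 * A + 1)] for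
   two Taylor remainders and the displacement of [x'], and the last term for freezing the metric at
   [x]. *)
pose Q := C + L * (2 * A + 1) + 2 * K * (A + 1) ^+ 2.
have Q0 : 0 <= Q by rewrite !addr_ge0// !mulr_ge0// ?sqr_ge0// addr_ge0// mulr_ge0.
(* From [|u - w|^2 = 2 (1 + |w|^2) - S^2] with [|w|^2 <= 1 + 3 K2 A e] and [S^2 >= 4 - 4 Q e]. *)
pose Q' := 6 * (K2 * A) + 4 * Q.
have K2A0 : 0 <= K2 * A by rewrite mulr_ge0.
(* In order: the expansion holds up to time [e]; [2 * e < r] leaves room to go back from [x']; two
   bounds let squares be estimated linearly; [e < 1]; the final error is below [(m * eta) ^+ 2]. *)
have [e e0 He] := exists_small
  [:: tau^-1; 2 / r; Q; K2 * A; 1; Q' / (m * eta) ^+ 2].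
have meta0 : 0 < m * eta by rewrite mulr_gt0.
have e1 : e < 1 by have := He 1; rewrite mulr1 !inE eqxx ?orbT; exact.
have etau : e < tau.
  by have := He tau^-1; rewrite !inE eqxx ltr_pdivrMr// mul1r; exact.
have er : 2 * e < r.
  have := He (2 / r); rewrite !inE eqxx orbT mulrA ltr_pdivrMr// mul1r mulrC; exact.
have eQ : e * Q < 1 by apply: He; rewrite !inE eqxx ?orbT.
have eK : e * (K2 * A) < 1 by apply: He; rewrite !inE eqxx ?orbT.
have eQ' : e * Q' < (m * eta) ^+ 2.
  have := He (Q' / (m * eta) ^+ 2).
  rewrite !inE eqxx !orbT mulrA ltr_pdivrMr ?exprn_gt0// mul1r; exact.
(* [d < e ^+ 2] turns the displacement of [x'] into a second-order error, and [d * C < e] ensures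
   [r - e <= r']. *)
have [d d0 Hd] := exists_small [:: (e ^+ 2)^-1; C / e].
have de2 : d < e ^+ 2.
  have := Hd (e ^+ 2)^-1; rewrite !inE eqxx ltr_pdivrMr ?exprn_gt0// mul1r; exact.
have dC : d * C < e.
  have := Hd (C / e); rewrite !inE eqxx orbT mulrA ltr_pdivrMr// mul1r; exact.
have ee : e ^+ 2 <= e by rewrite expr2 ler_piMr// ltW.
exists d => // c' v' r' [ray' fc'] r'0.
set x' := c' r' => xd.
have xx' : `|x'| <= rho.
  rewrite -[x'](subrK x) (le_trans (ler_normD _ _))// addrC lerD2l.
  by rewrite (le_trans (ltW xd))//; lra.
have xx : `|x| <= rho by rewrite lerDl.
have up (z : 'rV[R]_n) : `|z| <= rho -> `|z| <= rho + 1 by move/le_trans; apply; rewrite lerDl.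
have CdE : C * `|x' - x| <= e.
  rewrite (le_trans _ (ltW dC))// mulrC ler_wpM2r//; exact: ltW.
have CdE2 : C * `|x' - x| <= C * e ^+ 2.
  rewrite ler_wpM2l// (le_trans (ltW xd))//; exact: ltW.
have r'r : r - e <= r' /\ r' - r <= C * e ^+ 2.
  have fx : f x = r by rewrite fc// ltW.
  have fx' : f x' = r' by rewrite fc'.
  have := HC x x' (up _ xx) (up _ xx'); have := HC x' x (up _ xx') (up _ xx).
  rewrite fx fx' [`|x - x'|]distrC => h1 h2; split; lra.
have [r're rr'] := r'r.
have re : e <= r' by lra.
pose p := c (r + e); pose q := c' (r' - e).
have fp : f p = r + e by rewrite fc//; lra.
have fq : f q = r' - e by rewrite fc'//; lra.
have segp := geodesic_ray_forward e (ltW r0) ray.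
have := HA e _ _ (ltW etau) segp; rewrite addr0 -/x => /(_ xx e).
rewrite lexx (ltW e0) -/p => /(_ isT)[pr _ px1 px2].
have segq := geodesic_ray_backward Hg re ray'.
have := HA e _ _ (ltW etau) segq; rewrite subr0 -/x' => /(_ xx' e).
rewrite lexx (ltW e0) -/q => /(_ isT)[qr _ qx1 qx2].
(* Evaluated at time 0, the expansion bounds the velocity [v' r'] itself. *)
have := HA e _ _ (ltW etau) segq; rewrite subr0 -/x' => /(_ xx' 0).
rewrite lexx (ltW e0) subr0 normrN => /(_ isT)[_ vA _ _].
set w := v' r' in vA qx2 *; set u := v r in px2 *.
have xde : `|x' - x| <= e ^+ 2 by rewrite (le_trans (ltW xd))// ltW.
have qx : `|q - x| <= (A + 1) * e.
  rewrite -(subrKA x') (le_trans (ler_normD _ _))// mulrDl mul1r lerD//.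
  exact: le_trans xde ee.
have px : `|p - x| <= (A + 1) * e by rewrite (le_trans px1)// ler_wpM2r ?lerDl// ltW.
have qp : `|q - p| <= 2 * ((A + 1) * e).
  by rewrite -(subrKA x) (le_trans (ler_normD _ _))// [`|x - p|]distrC; lra.
pose S := gnorm g x (u + w).
have pq : gnorm g x (q - p) <= e * S + L * ((2 * A + 1) * e ^+ 2).
  (* Main term [- e (u + w)], since both pieces are traversed from [p] towards [q] against their
     rays; the other three terms are of second order. *)
  have -> : q - p = (q - x' - e *: - w) + (x' - x) - (p - x - e *: u) - e *: (u + w).
    by apply/rowP => i; rewrite !mxE; ring.
  rewrite (le_trans (gnormD Hg _ _ _))// addrC lerD//.
    by rewrite gnormN// gnormZ// ger0_norm// ltW.
  rewrite (le_trans (HL _ _ (up _ xx)))// ler_wpM2l//.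
  rewrite (le_trans (ler_normB _ _))// [leRHS](_ : _ =
    (A * e ^+ 2 + e ^+ 2) + A * e ^+ 2); last by ring.
  by rewrite lerD// (le_trans (ler_normD _ _))// lerD.
have key : 2 <= S + Q * e.
  have := HK x p q _ (up _ xx) pr qr px qx; rewrite fp fq => H.
  have H1 : K * ((A + 1) * e) * `|q - p| <= K * ((A + 1) * e) * (2 * ((A + 1) * e)).
    by rewrite ler_wpM2l// !mulr_ge0 ?addr_ge0// ltW.
  have H2 : 2 * e <= (S + Q * e) * e.
    rewrite [leRHS](_ : _ = e * S + C * e ^+ 2 + L * ((2 * A + 1) * e ^+ 2) +
      K * ((A + 1) * e) * (2 * ((A + 1) * e))); last by rewrite /Q; ring.
    lra.
  by rewrite ler_pM2r in H2.
have nu : gnorm g x u = 1.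
  by have [_ _ _ _ n1] := ray; rewrite /gnorm n1 ?sqrtr1// ltW.
have nw : gnorm g x w <= 1 + K2 * A * e.
  rewrite (le_trans (HK2 x x' w (up _ xx) (up _ xx')))// lerD//.
    by have [_ _ _ _ n1] := ray'; rewrite /gnorm n1 ?sqrtr1.
  rewrite -mulrA -[leRHS]mulrA ler_wpM2l// mulrC ler_pM// distrC.
  exact: le_trans xde ee.
have := gnorm_parallelogram Hg x u w; rewrite nu -/S => par.
have S0 : 0 <= S by exact: gnorm_ge0.
have nw0 : 0 <= gnorm g x w by exact: gnorm_ge0.
have S2 : 4 - 4 * (Q * e) <= S ^+ 2.
  have : 2 - Q * e <= S by lra.
  have : 0 <= Q * e by rewrite mulr_ge0// ltW.
  rewrite [e * Q]mulrC in eQ; nra.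
have nw2 : gnorm g x w ^+ 2 <= 1 + 3 * (K2 * A * e).
  have : 0 <= K2 * A * e by rewrite mulr_ge0// ltW.
  rewrite [e * (K2 * A)]mulrC in eK; nra.
have uw : gnorm g x (u - w) ^+ 2 < (m * eta) ^+ 2.
  rewrite (le_lt_trans _ eQ')// /Q'; move: par; rewrite mulr2n; lra.
rewrite ltr_sqr ?nnegrE ?gnorm_ge0 ?ltW// in uw.
have := le_lt_trans (Hm x (u - w) (up _ xx)) uw.
by rewrite ltr_pM2l// distrC.
Qed.

End DistanceFunction.

(** * The homotopy *)

Section ChartHomotopy.
Variables (R : realType) (n : nat) (g : 'rV[R]_n -> 'M[R]_n).
Hypothesis Hg : riemannian_metric g.
Variable f : 'rV[R]_n -> R.
Hypothesis f_segment : forall (p q : 'rV[R]_n) (B : R),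
  (forall t, 0 <= t <= 1 -> gnorm g (p + t *: (q - p)) (q - p) <= B) ->
  f p <= f q + B.
Implicit Types (p q b w : 'rV[R]_n) (c v : R -> 'rV[R]_n).

(** By calibration and [f p <= 0], the time [r = f (c r)] is at most a multiple of [|c r - p|]. One
    [delta] serves all rays, whose directions near [p] are not controlled. *)
Lemma homotopy_continuous_at_zero p (eps : R) : f p <= 0 -> 0 < eps ->
  exists2 delta : R, 0 < delta & forall c v (r t : R), calibrated_ray g f c v ->
    0 <= t <= r -> `|c r - p| < delta -> `|c t - p| < eps.
Proof.
move=> fp e0; pose rho := `|p| + 1.
have [tau [A [tau0 A0 HA]]] := geodesic_segment_expansion Hg rho.
have [C C0 HC] := distance_lipschitz Hg f_segment rho.
have [d d0 Hd] := exists_small [:: 1; C / tau; C * A / (eps / 2); (eps / 2)^-1].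
have e20 : 0 < eps / 2 by rewrite divr_gt0.
have d1 : d < 1 by have := Hd 1; rewrite mulr1 !inE eqxx; exact.
have dtau : d * C < tau.
  have := Hd (C / tau); rewrite !inE eqxx orbT mulrA ltr_pdivrMr// mul1r; exact.
have dA : d * (C * A) < eps / 2.
  have := Hd (C * A / (eps / 2)).
  rewrite !inE eqxx !orbT mulrA ltr_pdivrMr// mul1r; exact.
have de : d < eps / 2.
  have := Hd (eps / 2)^-1; rewrite !inE eqxx !orbT ltr_pdivrMr// mul1r; exact.
exists d => // c v r t [ray fc] /andP[t0 tr] cd.
have r0 : 0 <= r by exact: le_trans tr.
have cr : `|c r| <= rho.
  rewrite -[c r](subrK p) (le_trans (ler_normD _ _))// addrC lerD2l.
  by rewrite (le_trans (ltW cd))// ltW.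
have rC : r <= C * `|c r - p|.
  by have := HC (c r) p cr; rewrite fc// lerDl => /(_ ler01); lra.
have rd : r <= d * C.
  by rewrite (le_trans rC)// mulrC ler_wpM2r// ltW.
have seg := geodesic_ray_backward Hg (lexx r) ray.
have := HA r _ _ (le_trans rd (ltW dtau)) seg; rewrite subr0 => /(_ cr (r - t)).
rewrite subKr subr_ge0 tr lerBlDr lerDl t0 => /(_ isT)[_ _ ct _].
rewrite -(subrKA (c r)) (le_lt_trans (ler_normD _ _))//.
have : A * (r - t) <= d * (C * A).
  by rewrite mulrA mulrC ler_wpM2r//; lra.
lra.
Qed.

(** Three errors of size [eps / 3]: from [c] to [c'] at a common backward time [m], along [c'] from
    time [m] to [s' * r'], and along [c] from [s * r] to [m]. *)
Lemma homotopy_continuous_at c v (r s eps : R) : calibrated_ray g f c v ->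
  0 < r -> 0 <= s <= 1 -> 0 < eps ->
  exists2 delta : R, 0 < delta & forall c' v' (r' s' : R),
    calibrated_ray g f c' v' -> 0 <= r' -> 0 <= s' <= 1 ->
    `|c' r' - c r| < delta -> `|s' - s| < delta ->
    `|c' ((1 - s') * r') - c ((1 - s) * r)| < eps.
Proof.
move=> cal r0 /andP[s0 s1] e0; have [ray fc] := cal.
have e30 : 0 < eps / 3 by rewrite divr_gt0.
have back := geodesic_ray_backward Hg (lexx r) ray.
have [rho Hrho] : exists rho, forall t, 0 <= t <= r -> `|c (r - t)| <= rho.
  have [cc _ _ _ _] := back.
  have c0 : {within `[0, r], continuous (fun=> 0 : 'rV[R]_n)}.
    by move=> ?; exact: cvg_cst.
  have [x _ Hx] := EVT_max (ltW r0) (within_continuous_distance cc c0).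
  by exists `|c (r - x) - 0| => t tr; have := Hx t; rewrite in_itv/= subr0; exact.
(* The expansion is restarted at [c' (r' - m)], which lies within [eps / 3] of a point of norm at
   most [rho]. *)
have [tau [A [tau0 A0 HA]]] := geodesic_segment_expansion Hg (rho + eps / 3).
have [C C0 HC] := distance_lipschitz Hg f_segment (rho + 1).
have [d1 d10 Hd1] := geodesic_dependence Hg (ltW r0) e30 back.
have [d2 d20 Hd2] := calibrated_velocity_continuous Hg f_segment cal r0 d10.
have sr : 0 <= s * r <= r by rewrite mulr_ge0 ?(ltW r0)//= ler_piMl// ltW.
have [d3 d30 Hd3] : exists2 d3 : R, 0 < d3 & forall m, 0 <= m <= r ->
    `|m - s * r| < d3 -> `|c (r - m) - c (r - s * r)| < eps / 3.
  have [cc _ _ _ _] := back; move: cc => /subspace_continuousP/(_ (s * r)).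
  rewrite /= in_itv/= => /(_ sr)/cvgrPdist_lt/(_ _ e30).
  rewrite near_withinE => -[d /= d0 Hd]; exists d => // m mr md.
  rewrite distrC; apply: Hd; last by rewrite /= in_itv.
  by rewrite /ball/= distrC.
have d320 : 0 < d3 / 2 by rewrite divr_gt0.
(* [d1] and [d2] serve the dependence on position and velocity at the starting point; the entries
   with [tau] and [eps] the excess [s' * r' - m <= d * C]; the last two share [d3] between the
   changes of [s] and [r]. *)
have [d d0 Hd] := exists_small [:: 1; C; d1^-1; d2^-1; C / tau;
  C * A / (eps / 3); (r + 1) / (d3 / 2); C / (d3 / 2)].
have dlt1 : d < 1 by have := Hd 1; rewrite mulr1 !inE eqxx; exact.
have dC : d * C < 1 by apply: Hd; rewrite !inE eqxx !orbT.
have dd1 : d < d1.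
  have := Hd d1^-1; rewrite !inE eqxx !orbT ltr_pdivrMr// mul1r; exact.
have dd2 : d < d2.
  have := Hd d2^-1; rewrite !inE eqxx !orbT ltr_pdivrMr// mul1r; exact.
have dtau : d * C < tau.
  have := Hd (C / tau); rewrite !inE eqxx !orbT mulrA ltr_pdivrMr// mul1r; exact.
have dA : d * (C * A) < eps / 3.
  have := Hd (C * A / (eps / 3)).
  rewrite !inE eqxx !orbT mulrA ltr_pdivrMr// mul1r; exact.
have dr : d * (r + 1) < d3 / 2.
  have := Hd ((r + 1) / (d3 / 2)).
  rewrite !inE eqxx !orbT mulrA ltr_pdivrMr// mul1r; exact.
have dC3 : d * C < d3 / 2.
  have := Hd (C / (d3 / 2)).
  rewrite !inE eqxx !orbT mulrA ltr_pdivrMr// mul1r; exact.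
exists d => // c' v' r' s' cal' r'0 /andP[s'0 s'1] cd sd.
have [ray' fc'] := cal'.
have cr : `|c r| <= rho by have := Hrho 0; rewrite subr0 lexx ltW//; exact.
have cr' : `|c' r'| <= rho + 1.
  rewrite -[c' r'](subrK (c r)) (le_trans (ler_normD _ _))// addrC lerD//.
  by rewrite (le_trans (ltW cd))// ltW.
have rr' : `|r' - r| <= d * C.
  have cr1 : `|c r| <= rho + 1 by rewrite (le_trans cr)// lerDl.
  have := HC _ _ cr1 cr'; have := HC _ _ cr' cr1.
  rewrite !fc ?fc'// ?(ltW r0)// [`|c r - _|]distrC => h1 h2.
  have : C * `|c' r' - c r| <= d * C by rewrite mulrC ler_wpM2r// ltW.
  by move=> h3; rewrite ler_norml; apply/andP; split; lra.
have s'r' : 0 <= s' * r' <= r' by rewrite mulr_ge0//= ler_piMl.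
pose m := Num.min (s' * r') r.
have [m0 mr mr' ms] : [/\ 0 <= m, m <= r, m <= r' & s' * r' - m <= d * C].
  have [s'r'0 s'r'1] := andP s'r'; have := ler_norm (r' - r).
  have dC0 : 0 <= d * C by rewrite mulr_ge0// ltW.
  by rewrite /m; case: (leP (s' * r') r) => H h; split; lra.
(* m truncates s' r' to [0, r], the only times at which t |-> c (r - t) is known
   to be a geodesic. *)
have msr : `|m - s * r| < d3.
  have H : `|m - s * r| <= `|s' * r' - s * r|.
    rewrite /m; case: (leP (s' * r') r) => // H.
    by case/andP: sr => ? ?; rewrite !ger0_norm//; lra.
  rewrite (le_lt_trans H)//.
  have -> : s' * r' - s * r = (s' - s) * r' + s * (r' - r) by ring.
  rewrite (le_lt_trans (ler_normD _ _))// !normrM (ger0_norm r'0) (ger0_norm s0).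
  have h1 : `|s' - s| * r' <= d * (r + 1).
    rewrite ler_pM// ?(ltW sd)//; have := ler_norm (r' - r); lra.
  have h2 : s * `|r' - r| <= d * C.
    by rewrite (le_trans _ rr')// ler_piMl.
  lra.
have E1 : `|c' (r' - m) - c (r - m)| < eps / 3.
  have := Hd1 m _ _ mr (geodesic_ray_backward Hg mr' ray'); rewrite !subr0.
  move=> /(_ (lt_trans cd dd1)); rewrite -opprD normrN => /(_ _ m); apply.
    exact: (Hd2 c' v' r' cal' r'0 (lt_trans cd dd2)).
  by rewrite m0 lexx.
have E2 : `|c' (r' - s' * r') - c' (r' - m)| < eps / 3.
  have m'0 : 0 <= s' * r' - m by rewrite subr_ge0 ge_min lexx.
  have le1 : s' * r' - m <= r' - m by rewrite lerD2r; case/andP: s'r'.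
  have := HA _ _ _ (le_trans ms (ltW dtau)) (geodesic_ray_backward Hg le1 ray').
  rewrite subr0 => /(_ _ (s' * r' - m)) [||_ _ H _].
  - rewrite -[c' _](subrK (c (r - m))) (le_trans (ler_normD _ _))// addrC lerD//.
      by apply: Hrho; rewrite m0.
    exact: ltW.
  - by rewrite m'0 lexx.
  move: H; have -> : r' - m - (s' * r' - m) = r' - s' * r' by ring.
  move=> H; rewrite (le_lt_trans H)// (le_lt_trans _ dA)//.
  by rewrite mulrA [leRHS]mulrC ler_wpM2l.
have mI : 0 <= m <= r by rewrite m0.
have E3 := Hd3 m mI msr.
have -> : (1 - s') * r' = r' - s' * r' by ring.
have -> : (1 - s) * r = r - s * r by ring.
rewrite -(subrKA (c' (r' - m))) -(subrKA (c (r - m)) (c' (r' - m))).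
rewrite (le_lt_trans (ler_normD _ _))//.
have := ler_normD (c' (r' - m) - c (r - m)) (c (r - m) - c (r - s * r)).
lra.
Qed.

End ChartHomotopy.

(** A point of [G] closer than [s] to [gamma s] would lie in the horobowl, which bounds [f] from
    below; [ray_distance_upper] bounds it from above. Positivity at [x] holds because the ray starts
    in [G] while [x] lies outside. *)
Lemma weakly_convex_calibrated (R : realType) (n : nat) (M : Type)
    (phi : M -> 'rV[R]_n) (psi : 'rV[R]_n -> M) (g : 'rV[R]_n -> 'M[R]_n)
    (G : set M) (x : M) :
  riemannian_metric g -> cancel phi psi -> cancel psi phi -> G !=set0 ->
  weakly_convex phi g G -> ~ G x ->
  let f p := dist_to_set (riemannian_dist phi g) (psi p) G in
  exists gamma v, [/\ calibrated_ray g f (phi \o gamma) v, G (gamma 0),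
    gamma (f (phi x)) = x & 0 < f (phi x)].
Proof.
move=> Hg phiK psiK G0 [uniq conv] Gx f.
have [y [[Gy dy] _]] := uniq x Gx.
have [gamma [[v ray] gy [t t0 gt] disj]] := conv x y Gx (conj Gy dy).
have f_segment (p q : 'rV[R]_n) (B : R) :
    (forall t, 0 <= t <= 1 -> gnorm g (p + t *: (q - p)) (q - p) <= B) ->
    f p <= f q + B.
  by move=> H; apply: dist_to_set_segment => //; rewrite !psiK.
have f_ge0 p : 0 <= f p.
  apply: lb_le_inf; first by exists (riemannian_dist phi g (psi p) y); exists y.
  by move=> _ [z _ <-]; exact: riemannian_dist_ge0.
have fg s : 0 <= s -> f (phi (gamma s)) = s.
  move=> s0; apply/eqP; rewrite eq_le; apply/andP; split.
    rewrite (le_trans (ray_distance_upper Hg f_segment ray s0))//.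
    rewrite gerDr /f /= phiK gy; exact: dist_to_set_le0.
  have [->|s_neq0] := eqVneq s 0; first exact: f_ge0.
  have {}s0 : 0 < s by rewrite lt_neqAle eq_sym s_neq0.
  apply: lb_le_inf; first by exists (riemannian_dist phi g (psi (phi (gamma s))) y); exists y.
  move=> _ [z Gz <-]; rewrite phiK leNgt; apply/negP => zs.
  have : (open_horobowl (riemannian_dist phi g) gamma `&` G) z.
    by split => //; exists s.
  by rewrite disj.
have fx : f (phi x) = t by rewrite -gt fg.
exists gamma, v; split => //; first by rewrite gy.
  by rewrite fx.
rewrite fx lt_neqAle t0 andbT; apply/eqP => t0'.
by apply: Gx; rewrite -gt -t0' gy.
Qed.

Theorem theorem2p1 (R : realType) (n : nat) (M : topologicalType)
    (phi : M -> 'rV[R]_n) (g : 'rV[R]_n -> 'M[R]_n)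
    (Hphi : homeomorphism phi)
    (Hg : riemannian_metric g)
    (Hcomplete : complete_dist (riemannian_dist phi g))
    (Hcurv : exists k : R, forall x u v : 'rV[R]_n, row_free (col_mx u v) ->
       - k ^+ 2 <= sectional_curvature g x u v <= 0)
    (G : set M) (Gclosed : closed G) (Gnonempty : G !=set0)
    (Gconvex : weakly_convex phi g G) :
  deformation_retract R G.
Proof.
have [phi_cont [psi [psi_cont phiK psiK]]] := Hphi.
pose f p := dist_to_set (riemannian_dist phi g) (psi p) G.
have f_segment (p q : 'rV[R]_n) (B : R) :
    (forall t, 0 <= t <= 1 -> gnorm g (p + t *: (q - p)) (q - p) <= B) ->
    f p <= f q + B.
  by move=> H; apply: dist_to_set_segment => //; rewrite !psiK.
(* The implication sits under the existential, so that one ray can be chosen for every point; on [G]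
   a constant map fills the gap. *)
have /choice[gam gamP] : forall x, exists gamma : R -> M, ~ G x -> exists v,
    [/\ calibrated_ray g f (phi \o gamma) v, G (gamma 0),
        gamma (f (phi x)) = x & 0 < f (phi x)].
  move=> x; have [Gx|Gx] := pselect (G x); first by exists (fun=> x).
  have [gamma [v H]] := weakly_convex_calibrated Hg phiK psiK Gnonempty Gconvex Gx.
  by exists gamma => _; exists v.
pose H (z : M * R) : M :=
  if pselect (G z.1) then z.1 else gam z.1 ((1 - z.2) * f (phi z.1)).
have HG x s : G x -> H (x, s) = x by rewrite /H /=; case: pselect.
have HnG x s : ~ G x -> H (x, s) = gam x ((1 - s) * f (phi x)).
  by rewrite /H /=; case: pselect.
exists H; split => [|x|x|x t Gx _]; last exact: HG.
(* Continuity is tested after [phi], where the estimates live, and carried back to [M] by [psi]. *)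
- suff Hphicont : forall (x : M) (s : R), 0 <= s <= 1 -> forall eps : R, 0 < eps ->
      \forall z \near (x, s), 0 <= z.2 <= 1 -> `|phi (H (x, s)) - phi (H z)| < eps.
    apply/subspace_continuousP => -[x s] [_ /=]; rewrite in_itv/= => s01.
    have phiH : phi (H z) @[z --> within ([set: M] `*` `[0, 1]%classic)
        (nbhs (x, s))] --> phi (H (x, s)).
      apply/cvgrPdist_lt => eps eps0; rewrite near_withinE.
      have := Hphicont x s s01 eps eps0.
      by apply: filterS => z Hz [_ /=]; rewrite in_itv/=; exact: Hz.
    have := cvg_comp _ _ phiH (psi_cont _); rewrite phiK.
    by under [X in X @ _]eq_fun do rewrite /= phiK.
  move=> x s s01 eps eps0.
  have near_phi (d : R) : 0 < d ->
      \forall z \near (x, s), `|phi z.1 - phi x| < d /\ `|z.2 - s| < d.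
    move=> d0; have /cvgrPdist_lt/(_ _ d0) h1 := phi_cont x.
    exists ([set x' | `|phi x - phi x'| < d], [set s' | `|s - s'| < d]).
      split=> //=; exact: (@cvgr_dist_lt _ _ _ (nbhs s) _ id s cvg_id d d0).
    by move=> [x' s'] [/= ? ?]; rewrite distrC [`|s' - s|]distrC.
  have [Gx|Gx] := pselect (G x).
    have fx : f (phi x) <= 0 by rewrite /f phiK; exact: dist_to_set_le0.
    have [d d0 Hd] := homotopy_continuous_at_zero Hg f_segment fx eps0.
    have de0 : 0 < Num.min d eps by rewrite lt_min d0.
    apply: filterS (near_phi _ de0) => -[x' s'] [/= + _] /andP[s'0 s'1].
    rewrite lt_min => /andP[xd xe]; rewrite HG// distrC.
    have [Gx'|Gx'] := pselect (G x'); first by rewrite HG.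
    rewrite HnG//; have [v [cal _ gx' fx'0]] := gamP x' Gx'.
    apply: (Hd _ v (f (phi x')) _ cal); last by rewrite /= gx'.
    by rewrite mulr_ge0 ?subr_ge0 ?(ltW fx'0)//= ler_piMl ?(ltW fx'0)// gerBl.
  have [v [cal _ gx fx0]] := gamP x Gx.
  have [d d0 Hd] := homotopy_continuous_at Hg f_segment cal fx0 s01 eps0.
  (* Closedness of [G]: the branch of [H] that follows rays is in force on a whole neighbourhood. *)
  have nG : \forall z \near (x, s), ~ G z.1.
    have oG : open (~` G) by exact: closed_openC.
    exists (~` G, setT); last by move=> [x' s'] [].
    by split; [exact: open_nbhs_nbhs | exact: filterT].
  apply: filterS2 nG (near_phi _ d0) => -[x' s'] /= Gx' [xd sd] s'01.
  rewrite !HnG// distrC; have [v' [cal' _ gx' fx'0]] := gamP x' Gx'.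
  apply: (Hd _ v' _ _ cal') => //; first exact: ltW.
  by rewrite /= gx gx'.
- have [Gx|Gx] := pselect (G x); first exact: HG.
  by rewrite HnG// subr0 mul1r; have [v []] := gamP x Gx.
- have [Gx|Gx] := pselect (G x); first by rewrite HG.
  by rewrite HnG// subrr mul0r; have [v []] := gamP x Gx.
Qed.
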